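(* Suppose $X^1_0,\ldots,X^n_0$ are iid and integrable with law $\mu_0\in\mathcal{P}(\mathbb{R}^d)$. Suppose $\mathbf{b}=(b^1,\ldots,b^n)$ is given by $$b^i(\mathbf{x})=K_1(x^i)+\sum_{j\ne i}A_{ij}K_2(x^i,x^j),\qquad\mathbf{x}\in(\mathbb{R}^d)^n,$$ for Lipschitz functions $K_1:\mathbb{R}^d\to\mathbb{R}^d$ and $K_2:\mathbb{R}^d\times\mathbb{R}^d\to\mathbb{R}^d$, and for any $n\times n$ matrix $A$ with zero diagonal and row sums $\sum_jA_{ij}=1$ for all $i$. Then the law of the solution $\mathbf{X}=(X^1,\ldots,X^n)$ of the independent projection SDE with drift $\mathbf{b}$, initialized from $(X^1_0,\ldots,X^n_0)$, is $\overline\mu^{\otimes n}$, where $\overline\mu$ is the law (on path space $C(\mathbb{R}_+;\mathbb{R}^d)$) of the unique solution of the McKean-Vlasov equation $$d\overline Y_t=\Big(K_1(\overline Y_t)+\int_{\mathbb{R}^d}K_2(\overline Y_t,x)\,\overline\mu_t(dx)\Big)dt+\sqrt2\,d\overline B_t,\qquad\overline Y_0\sim\mu_0,\quad\overline\mu_t=\mathrm{Law}(\overline Y_t).$$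
   Context: $d,n$ are positive integers and $\mathbb{R}_+=[0,\infty)$. Independent projection SDE with (Lipschitz) drift $\mathbf{b}=(b^1,\ldots,b^n):(\mathbb{R}^d)^n\to(\mathbb{R}^d)^n$: the McKean-Vlasov equation $$dX^i_t=\Big(\int_{\mathbb{R}^{d(n-1)}}b^i(X^i_t,\mathbf{x}^{-i})\,\mu_t^{-i}(d\mathbf{x}^{-i})\Big)dt+\sqrt2\,dB^i_t,\quad \mu_t=\mathrm{Law}(\mathbf{X}_t),\quad i=1,\ldots,n,$$ where $B^1,\ldots,B^n$ are independent standard $d$-dimensional Brownian motions, independent of $\mathbf{X}_0$. Here $\mathbf{x}^{-i}$ is $\mathbf{x}$ with the $i$th coordinate removed, $(y,\mathbf{x}^{-i})$ is $\mathbf{x}$ with the $i$th coordinate replaced by $y$, and $\mu^{-i}$ is the pushforward of $\mu$ under $\mathbf{x}\mapsto\mathbf{x}^{-i}$. Likewise $\overline B$ is a standard $d$-dimensional Brownian motion independent of $\overline Y_0$. *)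

(* Defs.v *)
From HB Require Import structures.
From mathcomp Require Import all_boot all_order all_algebra.
From mathcomp Require Import all_classical all_reals all_analysis.

Set Implicit Arguments.
Unset Strict Implicit.
Unset Printing Implicit Defensive.

Import Order.TTheory GRing.Theory Num.Theory.
Import numFieldNormedType.Exports.

Local Open Scope classical_set_scope.
Local Open Scope ring_scope.

(** * Borel sigma-algebra on matrices *)

(* R^d is ['rV[R]_d] and (R^d)^n is ['M[R]_(n, d)], the i-th row being x^i.
   MathComp-Analysis puts a topology but no sigma-algebra on matrices. *)
Section borel_matrix.
Variables (R : realType) (m n : nat).

Definition borel_matrix : set (set 'M[R]_(m, n)) := <<s open >>.

Let borel_matrixC (A : set 'M[R]_(m, n)) :
  borel_matrix A -> borel_matrix (~` A).
Proof. exact: sigma_algebraC. Qed.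

HB.instance Definition _ := @isMeasurable.Build (sigma_display borel_matrix)
  'M[R]_(m, n) borel_matrix
  (@sigma_algebra0 _ setT open) borel_matrixC
  (@sigma_algebra_bigcup _ setT open).

End borel_matrix.

(** * Path space C(R_+; R^d) *)

Definition rplus (R : realType) : Type := set_type (`[0, +oo[%classic : set R).
HB.instance Definition _ (R : realType) := Topological.on (rplus R).

Lemma max0_rplus (R : realType) (t : R) : Num.max 0 t \in (`[0, +oo[%classic : set R).
Proof. by rewrite inE /= in_itv /= andbT le_max lexx. Qed.

(* The retraction of R onto R_+: it lets paths be evaluated at real times. *)
Definition to_rplus (R : realType) (t : R) : rplus R :=
  exist _ (Num.max 0 t) (max0_rplus t).

Definition cpath (R : realType) (d : nat) : Type :=
  continuousType (rplus R) 'rV[R]_d.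

HB.instance Definition _ (R : realType) (d : nat) := Choice.on (cpath R d).
HB.instance Definition _ (R : realType) (d : nat) :=
  isPointed.Build (cpath R d) (cst 0 : continuousType (rplus R) 'rV[R]_d).
(* Uniform convergence on compact sets. *)
HB.instance Definition _ (R : realType) (d : nat) :=
  Topological.copy (cpath R d)
    (initial_topology
      (id : continuousType (rplus R) 'rV[R]_d ->
            {family compact, rplus R -> 'rV[R]_d})).

Definition path_at (R : realType) (d : nat) (w : cpath R d) (t : R) :
  'rV[R]_d := (w : continuousType (rplus R) 'rV[R]_d) (to_rplus t).

Section borel_path.
Variables (R : realType) (d : nat).

Definition borel_path : set (set (cpath R d)) := <<s open >>.

Let borel_pathC (A : set (cpath R d)) : borel_path A -> borel_path (~` A).
Proof. exact: sigma_algebraC. Qed.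

HB.instance Definition _ := @isMeasurable.Build (sigma_display borel_path)
  (cpath R d) borel_path
  (@sigma_algebra0 _ setT open) borel_pathC
  (@sigma_algebra_bigcup _ setT open).

End borel_path.

(** * Product measures *)

Section power_measure.
Context (disp : measure_display) (T : measurableType disp) (R : realType).

Definition tuple_cons (n : nat) (x : T * n.-tuple T) : n.+1.-tuple T :=
  [tuple of x.1 :: x.2].

Let measurable_tuple_cons (n : nat) :
  measurable_fun [set: T * n.-tuple T] (@tuple_cons n).
Proof. by apply: measurable_cons. Qed.

HB.instance Definition _ (n : nat) :=
  @isMeasurableFun.Build _ _ (T * n.-tuple T)%type (n.+1.-tuple T)
    (@tuple_cons n) (@measurable_tuple_cons n).

Fixpoint power_measure (mu : probability T R) (n : nat) :
    probability (n.-tuple T) R :=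
  match n with
  | 0 => \d_([tuple] : 0.-tuple T)
  | n.+1 => distribution (mu \x power_measure mu n)%E (@tuple_cons n)
  end.

Lemma power_measure_box (mu : probability T R) (n : nat) (A : 'I_n -> set T) :
  (forall i, measurable (A i)) ->
  power_measure mu n [set x | forall i, A i (tnth x i)] =
    (\prod_(i < n) mu (A i))%E.
Proof.
elim: n A => [|n IHn] A mA.
  rewrite big_ord0 /= diracE mem_set //.
  by case.
rewrite big_ord_recl -IHn; last by move=> i; exact: mA.
rewrite /= /distribution /pushforward.
rewrite (_ : _ @^-1` _ = A ord0 `*`
    [set x | forall i : 'I_n, A (lift ord0 i) (tnth x i)]).
  rewrite product_measure1E //.
  rewrite (_ : [set _ | _] = \big[setI/setT]_(i < n)
      ((fun x : n.-tuple T => tnth x i) @^-1` A (lift ord0 i))).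
    apply: bigsetI_measurable => i _.
    by rewrite -[X in measurable X]setTI; exact: measurable_tnth.
  rewrite -bigcap_seq; apply/seteqP; split=> [x Ax i _|x Ax i]; first exact: Ax.
  by apply: Ax; rewrite /= mem_index_enum.
apply/seteqP; split=> -[x u] /= Axu.
  split=> [|i]; first by have := Axu ord0; rewrite (tnth_nth x).
  by have := Axu (lift ord0 i); rewrite tnthS.
move=> i; case: (unliftP ord0 i) => [j ->|->].
  by rewrite tnthS; exact: Axu.2.
by rewrite (tnth_nth x); exact: Axu.1.
Qed.

End power_measure.

(** * Independence *)

Section independence.
Context (dW : measure_display) (W : measurableType dW) (R : realType).
Variable P : probability W R.

(* Subfamilies are covered by taking some of the [A i] equal to [setT]. *)
Definition indep_family (dT : measure_display) (T : measurableType dT)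
    (n : nat) (X : 'I_n -> W -> T) : Prop :=
  forall A : 'I_n -> set T, (forall i, measurable (A i)) ->
    P [set w | forall i, A i (X i w)] = (\prod_(i < n) P (X i @^-1` A i))%E.

Definition indep_pair (dS dT : measure_display) (S : measurableType dS)
    (T : measurableType dT) (X : W -> S) (Y : W -> T) : Prop :=
  forall (A : set S) (C : set T), measurable A -> measurable C ->
    P (X @^-1` A `&` Y @^-1` C) = (P (X @^-1` A) * P (Y @^-1` C))%E.

End independence.

(** * Vector-valued integrals, coordinate by coordinate *)

Section vector_integral.
Context (dT : measure_display) (T : measurableType dT) (R : realType) (d : nat).
Variables (mu : set T -> \bar R) (D : set T) (f : T -> 'rV[R]_d).

Definition vintegrable : Prop :=
  forall k, mu.-integrable D (fun x => (f x 0 k)%:E).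

Definition vintegral : 'rV[R]_d :=
  \row_k fine (\int[mu]_(x in D) (f x 0 k)%:E)%E.

End vector_integral.

(** * Brownian motion *)

(* In the second clause, the product is N(0, (t - s) I_d). *)
Definition brownian (dW : measure_display) (W : measurableType dW)
    (R : realType) (P : probability W R) (d : nat) (B : W -> cpath R d) :
    Prop :=
  [/\ \forall w \ae P, path_at (B w) 0 = 0,
      forall s t : R, 0 <= s -> s < t ->
        forall A : 'I_d -> set R, (forall k, measurable (A k)) ->
          P [set w | forall k, A k ((path_at (B w) t - path_at (B w) s) 0 k)] =
          (\prod_(k < d) normal_prob 0 (Num.sqrt (t - s)) (A k))%E
    & forall (m : nat) (t : nat -> R), 0 <= t 0%N ->
        (forall j, t j <= t j.+1) ->
        indep_family P (fun (j : 'I_m) w =>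
          path_at (B w) (t j.+1) - path_at (B w) (t j))].

(** * Stochastic differential equations *)

Section sde.
Context (dW : measure_display) (W : measurableType dW) (R : realType).
Variables (P : probability W R) (d : nat).

(* dX_t = beta(t, X_t) dt + sqrt 2 dB_t with X_0 = xi. The noise being
   additive, the equation is solved path by path and no stochastic integral
   is needed. *)
Definition additive_sde (beta : R -> 'rV[R]_d -> 'rV[R]_d)
    (xi : W -> 'rV[R]_d) (B X : W -> cpath R d) : Prop :=
  \forall w \ae P, forall t : R, 0 <= t ->
    vintegrable lebesgue_measure `[0, t] (fun s => beta s (path_at (X w) s)) /\
    path_at (X w) t =
      xi w
      + vintegral lebesgue_measure `[0, t] (fun s => beta s (path_at (X w) s))
      + Num.sqrt 2 *: path_at (B w) t.

(* dY_t = (K1(Y_t) + \int K2(Y_t, x) mu_t(dx)) dt + sqrt 2 dB_t,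
   mu_t = Law(Y_t). *)
Section mckean_vlasov.
Variables (K1 : 'rV[R]_d -> 'rV[R]_d) (K2 : 'rV[R]_d * 'rV[R]_d -> 'rV[R]_d).

Definition law_at (Y : W -> cpath R d) (t : R) : set 'rV[R]_d -> \bar R :=
  pushforward P (fun w => path_at (Y w) t).

Definition mv_drift (mu : set 'rV[R]_d -> \bar R) (y : 'rV[R]_d) : 'rV[R]_d :=
  K1 y + vintegral mu setT (fun x => K2 (y, x)).

Definition mv_solution (xi : W -> 'rV[R]_d) (B Y : W -> cpath R d) : Prop :=
  (forall (t : R) (y : 'rV[R]_d), 0 <= t ->
     vintegrable (law_at Y t) setT (fun x => K2 (y, x))) /\
  additive_sde (fun t => mv_drift (law_at Y t)) xi B Y.

End mckean_vlasov.

(* dX^i_t = (\int b^i(X^i_t, x^{-i}) mu_t^{-i}(dx^{-i})) dt + sqrt 2 dB^i_t,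
   mu_t = Law(X_t). *)
Section independent_projection.
Variables (n : nat) (b : 'I_n -> 'M[R]_(n, d) -> 'rV[R]_d).

Definition joint_law_at (X : 'I_n -> W -> cpath R d) (t : R) :
    set 'M[R]_(n, d) -> \bar R :=
  pushforward P (fun w => \matrix_(i < n) path_at (X i w) t).

(* mu^{-i}: [row' i x] is x^{-i}. *)
Definition drop_law (i : 'I_n) (mu : set 'M[R]_(n, d) -> \bar R) :
    set 'M[R]_(n.-1, d) -> \bar R :=
  pushforward mu (row' i).

(* (y, x^{-i}): row [i] is [y], the other rows are those of [z], in order. *)
Definition insert_row (i : 'I_n) (y : 'rV[R]_d) (z : 'M[R]_(n.-1, d)) :
    'M[R]_(n, d) :=
  \matrix_(j < n) (if unlift i j is Some k then row k z else y).

Definition ip_drift (i : 'I_n) (mu : set 'M[R]_(n, d) -> \bar R)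
    (y : 'rV[R]_d) : 'rV[R]_d :=
  vintegral (drop_law i mu) setT (fun z => b i (insert_row i y z)).

Definition ip_solution (xi : 'I_n -> W -> 'rV[R]_d)
    (B X : 'I_n -> W -> cpath R d) : Prop :=
  forall i : 'I_n,
    (forall (t : R) (y : 'rV[R]_d), 0 <= t ->
       vintegrable (drop_law i (joint_law_at X t)) setT
         (fun z => b i (insert_row i y z))) /\
    additive_sde (fun t => ip_drift i (joint_law_at X t)) (xi i) (B i) (X i).

End independent_projection.

End sde.

(* Main.v *)
From HB Require Import structures.
From mathcomp Require Import all_boot all_order all_algebra.
From mathcomp Require Import all_classical all_reals all_analysis.
From mathcomp Require Import measurable_realfun ring lra.
Require Import Defs.

Set Implicit Arguments.
Unset Strict Implicit.
Unset Printing Implicit Defensive.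

Import Order.TTheory GRing.Theory Num.Theory.
Import numFieldNormedType.Exports.

Local Open Scope classical_set_scope.
Local Open Scope ring_scope.

(** Both equations have additive noise, so they are solved path by path, and
    the drift each particle feels at time [s] is a Lipschitz function of its
    position, averaged over a law.  The theorem rests on one observation.
    Write [K (y, x) = K1 y + K2 (y, x)] and let [nu] be the law of the path
    [Y0 + sqrt 2 Bbar].  Picard iteration on path space yields a single
    measurable map [F], depending only on [K] and [nu], with
      [F x t = x t + \int_0^t \int K (F x s, F z s) nu(dz) ds]
    for every path [x] ([picard_fixpoint]).  Feeding [Y0 + sqrt 2 Bbar] to [F]
    gives a solution of the McKean-Vlasov equation.  Feeding the [n] paths
    [X0 i + sqrt 2 B i] to [F], one by one, gives a solution of the independent
    projection SDE: each of them has law [nu], so all the averages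
    [E K2 (y, X^j_s)] are the same vector, and since row [i] of [A] sums to [1]
    with zero diagonal the weighted average over [j != i] is again that vector
    ([fixpoint_solves] and the computation in the final proof).

    What remains is uniqueness and the law.

    Uniqueness holds for any system in which every particle feels the average
    of a Lipschitz function of all the particles ([system_unique]); both
    equations are of this form ([mv_system], [ip_system]).  A solution is a
    process with continuous paths and no moment is part of the definition, so
    its mean is first shown to be locally bounded in time
    ([solution_locally_L1]) by comparing two trajectories of the same solution:
    the law enters both in the same way, hence only the Lipschitz dependence
    on the position is left.  Then the usual Gronwall argument is run, in the
    form [halving]: in a norm weighted by [expR (- lam t)] with [lam] large,
    any finite bound on the difference of two solutions can be halved.

    Hence every solution is almost surely the image under [F] of its driving
    paths, and the law of [X] is determined by the law of the pairs
    [(X0 i, B i)].  These pairs are independent ([indep_family_pairs]), and each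
    path [X0 i + sqrt 2 B i] has the law of [Y0 + sqrt 2 Bbar], because the law
    of such a path is determined by its starting point and its increments over
    dyadic grids ([cpath_law_unique], [noise_grid_box]).

    Two groups of results prepare the ground.  Measurability of path-valued
    maps is reduced to their values at fixed times ([measurable_cpathP]) by a
    countable network of the compact-open topology.  The mean of a Brownian
    path at time [t] is bounded by a multiple of [sqrt t]
    ([brownian_norm_le]), so [nu] has locally bounded mean, which is
    all the integrability that the Picard scheme uses. *)

(** * Countable networks and Borel sigma-algebras *)

(** An open set is the union of the members of the network that it contains,
    and this union is countable.  It reduces the measurability of a map to the
    preimages of the members of the network. *)
Lemma sigma_algebra_network (X : Type) (I : countType) (E : I -> set X)
    (O F : set (set X)) :
  sigma_algebra setT F -> (forall i, F (E i)) ->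
  (forall U, O U -> forall x, U x -> exists2 i, E i x & E i `<=` U) ->
  <<s O >> `<=` F.
Proof.
move=> sF FE netE; apply: smallest_sub => // U OU.
have [F0 _ Fcup] := sF.
pose G k : set X := if @unpickle I k is Some i then
  if pselect (E i `<=` U) then E i else set0 else set0.
suff -> : U = \bigcup_k G k.
  by apply: Fcup => k; rewrite /G; case: (unpickle k) => [i|//]; case: pselect => _ /=.
apply/seteqP; split=> [x /(netE _ OU)[i Eix EiU]|x [k _]].
  by exists (pickle i) => //; rewrite /G pickleK; case: pselect.
by rewrite /G; case: (unpickle k) => [i|//]; case: pselect => [EU /EU|].
Qed.

Section matrix_norm.
Variables (R : realType) (m n : nat).
Implicit Types (x y : 'M[R]_(m, n)).

Lemma normr_mx_coord x i j : `|x i j| <= `|x|.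
Proof.
rewrite [leRHS]/Num.norm /= mx_normrE.
exact: (le_bigmax _ (fun ij => `|x ij.1 ij.2|) (i, j)).
Qed.

Lemma normr_mx_le x (e : R) : 0 <= e -> (forall i j, `|x i j| <= e) -> `|x| <= e.
Proof.
move=> e0 xe; rewrite [leLHS]/Num.norm /= mx_normrE.
by apply/bigmax_leP; split => // -[i j] _; exact: xe.
Qed.

End matrix_norm.

Lemma rat_approx (R : realType) (x e : R) : 0 < e -> exists q : rat, `|x - ratr q| < e.
Proof.
move=> e0; have /rat_in_itvoo[q] : x - e < x + e by rewrite ltrBlDr -addrA ltrDl addr_gt0.
rewrite in_itv /= => /andP[xq qx]; exists q.
by rewrite ltr_distl; apply/andP; split; lra.
Qed.

Lemma natr_inv_lt (R : realType) (e : R) : 0 < e -> exists k : nat, k.+1%:R^-1 < e.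
Proof.
move=> e0; exists (Num.truncn e^-1); rewrite invf_plt ?posrE //.
exact: truncnS_gt.
Qed.

Section borel_matrix_coordinates.
Variables (R : realType) (m n : nat).

Definition rat_box (ql : 'M[rat]_(m, n) * nat) : set 'M[R]_(m, n) :=
  [set x | forall i j, `|x i j - ratr (ql.1 i j)| <= ql.2.+1%:R^-1].

(** Rational boxes of small radius whose centre approximates [x]. *)
Lemma rat_box_network (U : set 'M[R]_(m, n)) : open U -> forall x, U x ->
  exists2 ql, rat_box ql x & rat_box ql `<=` U.
Proof.
move=> oU x Ux; have /nbhs_ballP[e /= e0 xeU] : nbhs x U by exact: open_nbhs_nbhs.
have [l le] : exists l : nat, l.+1%:R^-1 < e / 3 by apply: natr_inv_lt; rewrite divr_gt0.
have qP i j : exists q : rat, `|x i j - ratr q| < l.+1%:R^-1.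
  by apply: rat_approx; rewrite invr_gt0.
exists (\matrix_(i, j) xchoose (qP i j), l) => [i j /=|y yq /=].
  by rewrite mxE; exact/ltW/(xchooseP (qP i j)).
apply: xeU; rewrite -ball_normE /ball_ /=.
suff : `|x - y| <= 2 * l.+1%:R^-1.
  by move=> /le_lt_trans; apply; move: le; set c := _^-1 => le; lra.
apply: normr_mx_le => [|i j]; first by rewrite mulr_ge0 // invr_ge0.
have := yq i j; have := xchooseP (qP i j); rewrite /= !mxE => h1 h2.
rewrite -(subrKA (ratr (xchoose (qP i j)))) (le_trans (ler_normD _ _)) //.
by move: h1 h2; rewrite [`|y i j - _|]distrC; set c := _^-1; lra.
Qed.

End borel_matrix_coordinates.

Lemma measurable_forall d (T : measurableType d) (I : countType) (A : I -> set T) :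
  (forall i, measurable (A i)) -> measurable [set x | forall i, A i x].
Proof.
move=> mA; rewrite (_ : [set x | _] = ~` \bigcup_i ~` A i).
  apply: measurableC; apply: countable_bigcupT_measurable => // i.
  exact: measurableC.
rewrite setC_bigcup; apply/seteqP; split=> x /= Ax i; last first.
  by have := Ax i Logic.I; rewrite setCK.
by move=> _; rewrite setCK.
Qed.

Section measurable_matrix.
Variables (R : realType).

Lemma measurable_mx_coord m n i j :
  measurable_fun setT (fun x : 'M[R]_(m, n) => x i j).
Proof.
apply: (measurability _ (RGenOpens.measurableE R)) => _ [_ [a [b ->] <-]].
rewrite setTI; apply: sub_sigma_algebra; apply: open_comp; last exact: interval_open.
by move=> x _; exact: coord_continuous.
Qed.

(** The Borel sigma-algebra of matrices is generated by the coordinates, as a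
    rational box is cut out by finitely many of them. *)
Lemma measurable_mxP d (T : measurableType d) m n (f : T -> 'M[R]_(m, n)) :
  measurable_fun setT f <-> forall i j, measurable_fun setT (fun t => f t i j).
Proof.
split=> [mf i j|mf]; first exact: (measurableT_comp (measurable_mx_coord i j)).
move=> _ S mS.
suff : image_set_system setT f measurable S by [].
apply: (sigma_algebra_network (E := @rat_box R m n) (O := open)) mS => //.
- exact/sigma_algebra_image/sigma_algebra_measurable.
- move=> [q l]; rewrite /image_set_system /= setTI.
  apply: measurable_forall => i; apply: measurable_forall => j.
  rewrite -[X in measurable X]setTI; apply: measurable_fun_le => //.
  exact/measurableT_comp/measurable_funB.
- exact: rat_box_network.
Qed.

Lemma measurable_mx_continuous m n p q (f : 'M[R]_(m, n) -> 'M[R]_(p, q)) :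
  continuous f -> measurable_fun setT f.
Proof.
move=> cf; apply: (measurability (@open 'M[R]_(p, q)) erefl) => _ [U oU <-].
rewrite setTI; apply: sub_sigma_algebra; apply: open_comp => // x _; exact: cf.
Qed.

Section arithmetic.
Context d (T : measurableType d) (m n : nat).
Implicit Types f g : T -> 'M[R]_(m, n).

Lemma measurable_mx_norm f :
  measurable_fun setT f -> measurable_fun setT (fun t => `|f t|).
Proof.
apply: measurableT_comp; apply: (measurability _ (RGenOpens.measurableE R)).
move=> _ [_ [a [b ->] <-]]; rewrite setTI; apply: sub_sigma_algebra.
apply: open_comp; last exact: interval_open.
by move=> x _; exact: norm_continuous.
Qed.

Lemma measurable_mxD f g : measurable_fun setT f -> measurable_fun setT g ->
  measurable_fun setT (fun t => f t + g t).
Proof.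
move=> /measurable_mxP mf /measurable_mxP mg; apply/measurable_mxP => i j.
by under eq_fun do rewrite mxE; exact: measurable_funD.
Qed.

Lemma measurable_mxZ (a : R) f : measurable_fun setT f ->
  measurable_fun setT (fun t => a *: f t).
Proof.
move=> /measurable_mxP mf; apply/measurable_mxP => i j.
by under eq_fun do rewrite mxE; exact: measurable_funM.
Qed.

Lemma measurable_mxB f g : measurable_fun setT f -> measurable_fun setT g ->
  measurable_fun setT (fun t => f t - g t).
Proof.
move=> mf mg; apply: measurable_mxD => //.
by under eq_fun do rewrite -scaleN1r; exact: measurable_mxZ.
Qed.

End arithmetic.

End measurable_matrix.

(** * The path space *)

Section path_space.
Variables (R : realType) (d : nat).
Implicit Types w : cpath R d.

Lemma path_at_continuous w : continuous (path_at w).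
Proof.
move=> t; apply: continuous_comp; last exact: cts_fun.
apply: continuous_comp_initial => {}t /=.
by apply: continuous_max; [exact: cvg_cst|exact: cvg_id].
Qed.

(** Total, with the null path as default, so that continuity has to be proved
    only where the values are computed. *)
Definition path_of (f : R -> 'rV[R]_d) : cpath R d :=
  match pselect (continuous (f \o set_val : rplus R -> 'rV[R]_d)) with
  | left cf => mkcts cf
  | right _ => cst 0
  end.

(** Continuity is asked of the extension of [f] to all of [R] by its value at
    [0], which avoids working in the subspace topology of the half-line. *)
Lemma path_ofE f : continuous (fun t : R => f (Num.max 0 t)) ->
  forall t, 0 <= t -> path_at (path_of f) t = f t.
Proof.
move=> cf t t0; rewrite /path_at /path_of; case: pselect => [cf'|[]] /=.
  by rewrite /mkcts /= set_valE /= max_r.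
have -> : f \o set_val = (fun t => f (Num.max 0 t)) \o (set_val : rplus R -> R).
  apply/funext => -[u]; rewrite /= set_valE /= inE /= in_itv /= andbT => u0.
  by rewrite max_r.
move=> u; apply: continuous_comp; last exact: cf.
exact: initial_continuous.
Qed.

Lemma to_rplusK (u : rplus R) : to_rplus (set_val u) = u.
Proof.
case: u => u pu; apply: eq_exist; rewrite set_valE /=.
by move: (pu); rewrite inE /= in_itv /= andbT => /max_r.
Qed.

Lemma cpathP w w' : (forall t, 0 <= t -> path_at w t = path_at w' t) -> w = w'.
Proof.
move=> ww'; apply/continuousEP => u; rewrite -(to_rplusK u).
apply: ww'; rewrite set_valE; case: u => u /=.
by rewrite inE /= in_itv /= andbT.
Qed.

Definition close_until w (N e : R) : set (cpath R d) :=
  [set w' | forall t, 0 <= t <= N -> `|path_at w t - path_at w' t| < e].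

(** A compact subset of the half-line lies in some [[0, N]], so uniform
    closeness on [[0, N]] controls every basic neighbourhood. *)
Lemma nbhs_close_until w (U : set (cpath R d)) : nbhs w U ->
  exists N : nat, exists2 e : R, 0 < e & close_until w N%:R e `<=` U.
Proof.
(* The filter of uniform closeness on bounded intervals; it converges to [w]
   uniformly on compact sets. *)
pose G := filter_from [set Ne : nat * R | 0 < Ne.2]
  (fun Ne => [set f : rplus R -> 'rV[R]_d |
     forall u, set_val u <= Ne.1%:R -> `|(w : rplus R -> _) u - f u| < Ne.2]).
have FG : Filter G.
  apply: filter_from_filter; first by exists (0%N, 1) => /=.
  move=> [N e] [N' e'] /= e0 e'0; exists (maxn N N', Num.min e e') => /=.
    by rewrite lt_min e0.
  move=> f /= fw; split => u uN; have := fw u.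
    by rewrite lt_min => /(_ _)/andP[]//; rewrite (le_trans uN)// ler_nat leq_maxl.
  by rewrite lt_min => /(_ _)/andP[]//; rewrite (le_trans uN)// ler_nat leq_maxr.
have : {family compact, G --> (w : rplus R -> 'rV[R]_d)}.
  apply/fam_cvgP => A cA V /uniform_nbhs[E [entE EV]].
  move: entE; rewrite -entourage_ballE => -[e /= e0 eE].
  have : compact (set_val @` A : set R).
    by apply: continuous_compact cA; apply: continuous_subspaceT; exact: initial_continuous.
  move=> /compact_bounded[M [_ MA]].
  exists ((Num.truncn (M + 1)).+1, e) => //= f fw; apply: EV => u Au.
  apply: eE => /=; rewrite -ball_normE /ball_ /=; apply: fw.
  rewrite (le_trans (ler_norm _)) // (@le_trans _ _ (M + 1)) //.
    by apply: MA => //; [rewrite ltrDl|exists u].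
  exact/ltW/truncnS_gt.
move=> /= wG [_ [[V oV <-] Vw VU]].
have /wG[[N e] /= e0 NeV] : nbhs (w : {family compact, rplus R -> 'rV[R]_d}) V.
  exact: open_nbhs_nbhs.
exists N, e => // w' ww'; apply: VU; apply: NeV => u uN.
rewrite -(to_rplusK u); apply: ww'; rewrite uN andbT.
by case: u {uN} => u; rewrite set_valE /= inE /= in_itv /= andbT.
Qed.

(** Evaluation at [t] only sees the compact set [{t}]. *)
Lemma eval_cpath_continuous t : continuous (fun w => path_at w t).
Proof.
move=> w.
have c1 : {family compact, (fun w' : cpath R d => (w' : rplus R -> 'rV[R]_d)) @ w -->
    (w : rplus R -> 'rV[R]_d)}.
  move=> V VE.
  exact: (@initial_continuous (continuousType (rplus R) 'rV[R]_d)
    {family compact, rplus R -> 'rV[R]_d} id w V VE).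
have /fam_cvgP/(_ [set to_rplus t] (@compact_set1 _ _)) := c1.
rewrite (@uniform_set1 _ _ _ _ _ (fmap_filter _ (nbhs_filter w))).
move=> h; exact: (h (fmap_filter _ (nbhs_filter w))).
Qed.

Lemma measurable_eval t : measurable_fun setT (fun w => path_at w t).
Proof.
apply: (measurability (@open 'rV[R]_d) erefl) => _ [U oU <-].
rewrite setTI; apply: sub_sigma_algebra; apply: open_comp => // w _.
exact: eval_cpath_continuous.
Qed.

Definition dyadic (m j : nat) : R := j%:R / 2 ^+ m.

Definition dyadic_floor (m : nat) (t : R) : R := dyadic m (Num.truncn (2 ^+ m * t)).

Lemma dyadic_ge0 m j : 0 <= dyadic m j.
Proof. by rewrite divr_ge0 // exprn_ge0. Qed.

Lemma dyadic_floor_le m t : 0 <= t -> dyadic_floor m t <= t.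
Proof.
move=> t0; have p0 : 0 < 2 ^+ m :> R by rewrite exprn_gt0.
rewrite /dyadic_floor /dyadic ler_pdivrMr // mulrC truncn_le.
by rewrite mulr_ge0 // ltW.
Qed.

Lemma dyadic_floor_gt m t : t - 1 / 2 ^+ m < dyadic_floor m t.
Proof.
have p0 : 0 < 2 ^+ m :> R by rewrite exprn_gt0.
rewrite /dyadic_floor /dyadic ltrBlDr -mulrDl natr1 ltr_pdivlMr //.
by rewrite mulrC truncnS_gt.
Qed.

Lemma cvg_dyadic_floor t : 0 <= t -> dyadic_floor m t @[m --> \oo] --> t.
Proof.
move=> t0; apply/cvgrPdist_lt => e e0.
have := near_infty_natSinv_expn_lt (PosNum e0); apply: filterS => m /= me.
rewrite ger0_norm ?subr_ge0 ?dyadic_floor_le //.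
by have := dyadic_floor_gt m t; lra.
Qed.

Lemma path_at_max0 w t : path_at w (Num.max 0 t) = path_at w t.
Proof.
rewrite /path_at; congr (_ _); apply: eq_exist => /=.
by rewrite max_r // le_max lexx.
Qed.

(** Both sides are [0] at negative times, as truncation sends negative reals
    to [0]. *)
Lemma dyadic_floor_max0 m t : dyadic_floor m (Num.max 0 t) = dyadic_floor m t.
Proof.
rewrite /dyadic_floor /dyadic; congr (_%:R / _).
have [//|t0] := leP 0 t; rewrite mulr0 truncn0 truncn_floor ifF //.
by apply/negbTE; rewrite -ltNge pmulr_rlt0 // exprn_gt0.
Qed.

Lemma cvg_path_dyadic w t : path_at w (dyadic_floor m t) @[m --> \oo] --> path_at w t.
Proof.
rewrite -path_at_max0; under eq_fun do rewrite -dyadic_floor_max0.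
apply: (cvg_comp _ (path_at w)); last exact: path_at_continuous.
by apply: cvg_dyadic_floor; rewrite le_max lexx.
Qed.

(** Uniform continuity on [[0, N]]: compactness makes the mesh uniform in
    [t]. *)
Lemma path_dyadic_uniform w (N : nat) (e : R) : 0 < e -> exists m,
  forall t, 0 <= t <= N%:R -> `|path_at w t - path_at w (dyadic_floor m t)| < e.
Proof.
move=> e0.
have /compact_near_coveringP/near_covering_withinP cov := @segment_compact R 0 N%:R.
suff /filter_ex[m mP] : \forall m \near \oo, `[0, N%:R] `<=`
    [set t | `|path_at w t - path_at w (dyadic_floor m t)| < e].
  by exists m => t t0N; apply: mP; rewrite /= in_itv.
apply: (cov nat \oo (fun m t => `|path_at w t - path_at w (dyadic_floor m t)| < e)) => t.
rewrite /= in_itv /= => /andP[t0 tN].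
have /cvgrPdist_lt/(_ (e / 2)) := @path_at_continuous w t.
rewrite divr_gt0 // => /(_ isT)/nbhs_ballP[r /= r0 wr].
have r20 : 0 < r / 2 by rewrite divr_gt0.
near=> u m => /=; rewrite in_itv /= => /andP[u0 uN].
have tu : `|t - u| < r / 2 by near: u; exact: (@nbhsx_ballx _ R^o t _ r20).
have mr : 1 / 2 ^+ m < r / 2.
  by near: m; exact: (near_infty_natSinv_expn_lt (PosNum r20)).
have := dyadic_floor_gt m u; have := dyadic_floor_le m u0 => du ud.
have h1 : ball t r u by rewrite -ball_normE /ball_ /=; lra.
have h2 : ball t r (dyadic_floor m u).
  rewrite -ball_normE /ball_ /=; move: tu; rewrite !ltr_norml => /andP[tu ut].
  by apply/andP; split; lra.
rewrite -(subrKA (path_at w t)) (le_lt_trans (ler_normD _ _)) //.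
by have := wr _ h1; have := wr _ h2; rewrite /= [`|path_at w t - path_at w u|]distrC; lra.
Unshelve. all: by end_near. Qed.

(** The paths that stay, at dyadic times up to [N], within [1 / (l + 1)] of the
    step function of mesh [2 ^ -m] with rational values listed in [q].  Only
    countably many times are constrained, so measurability of such a box can
    be tested by evaluations. *)
Definition path_box (i : nat * nat * nat * seq 'rV[rat]_d) : set (cpath R d) :=
  let: (N, m, l, q) := i in
  [set w | forall p j, dyadic p j <= N%:R ->
     `|path_at w (dyadic p j) -
       map_mx ratr (nth 0 q (Num.truncn (2 ^+ m * dyadic p j)))| <= l.+1%:R^-1].

(** A path is uniformly close to a rational step function on [[0, N]].
    Conversely two paths in the same box are close at all dyadic times, hence
    at all times by continuity. *)
Lemma path_box_network (U : set (cpath R d)) : open U -> forall w, U w ->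
  exists2 i, path_box i w & path_box i `<=` U.
Proof.
move=> oU w Uw.
have /nbhs_close_until[N [e e0 weU]] : nbhs w U by exact: open_nbhs_nbhs.
have [l le] : exists l : nat, l.+1%:R^-1 < e / 3 by apply: natr_inv_lt; rewrite divr_gt0.
set c : R := l.+1%:R^-1 in le.
have c0 : 0 < c by rewrite invr_gt0.
have c20 : 0 < c / 2 by rewrite divr_gt0.
have [m mw] := path_dyadic_uniform w N c20.
have qP k : exists q : 'rV[rat]_d, `|path_at w (dyadic m k) - map_mx ratr q| <= c / 2.
  have qi i : exists q : rat, `|path_at w (dyadic m k) 0 i - ratr q| < c / 2.
    exact: rat_approx.
  exists (\row_i xchoose (qi i)); apply: normr_mx_le => [|i0 i]; first exact: ltW.
  by rewrite (ord1 i0) !mxE; exact/ltW/(xchooseP (qi i)).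
pose q := [seq xchoose (qP k) | k <- iota 0 (N * 2 ^ m).+1].
have wq : path_box (N, m, l, q) w.
  move=> p j jN.
  have kN : (Num.truncn (2 ^+ m * dyadic p j) < (N * 2 ^ m).+1)%N.
    rewrite truncn_lt_nat ?mulr_ge0 ?dyadic_ge0 //.
    rewrite (@le_lt_trans _ _ (N * 2 ^ m)%:R) ?ltr_nat // natrM natrX mulrC.
    by rewrite ler_wpM2r.
  rewrite (nth_map 0%N) ?size_iota // nth_iota // add0n -/c.
  have := xchooseP (qP (Num.truncn (2 ^+ m * dyadic p j))).
  have := mw (dyadic p j); rewrite dyadic_ge0 jN => /(_ isT).
  rewrite -/(dyadic_floor _ _) => h1 h2.
  rewrite -(subrKA (path_at w (dyadic_floor m (dyadic p j)))) (le_trans (ler_normD _ _)) //.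
  by rewrite [leRHS]splitr; exact: lerD (ltW h1) h2.
exists (N, m, l, q) => // w' w'q.
apply: weU => t /andP[t0 tN].
suff : `|path_at w t - path_at w' t| <= 2 * c by lra.
have cv : `|path_at w (dyadic_floor p t) - path_at w' (dyadic_floor p t)| @[p --> \oo]
    --> `|path_at w t - path_at w' t|.
  by apply: cvg_norm; apply: cvgB; exact: cvg_path_dyadic.
apply: (cvgr_to_le cv); apply: nearW => p.
have pN : dyadic_floor p t <= N%:R by rewrite (le_trans _ tN) // dyadic_floor_le.
have := wq p _ pN; have := w'q p _ pN; rewrite -/c.
set z := map_mx _ _ => h1 h2; rewrite -(subrKA z) (le_trans (ler_normD _ _)) //.
by rewrite mulr2n mulrDl mul1r; apply: lerD => //; rewrite distrC.
Qed.

(** Reduces measurability in path space to that of the values at fixed times,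
    since the boxes of the network are countable intersections of conditions
    on such values. *)
Lemma measurable_cpathP dT (T : measurableType dT) (f : T -> cpath R d) :
  measurable_fun setT f <->
  forall t, 0 <= t -> measurable_fun setT (fun x => path_at (f x) t).
Proof.
split=> [mf t _|mf]; first exact: (measurableT_comp (measurable_eval t)).
move=> _ S mS.
suff : image_set_system setT f measurable S by [].
apply: (sigma_algebra_network (E := path_box) (O := open)) mS => //.
- exact/sigma_algebra_image/sigma_algebra_measurable.
- move=> [[[N m] l] q]; rewrite /image_set_system /= setTI.
  apply: measurable_forall => p; apply: measurable_forall => j.
  have [jN|jN] := boolP (dyadic p j <= N%:R); last first.
    by rewrite [X in measurable X](_ : _ = setT) //; apply/seteqP; split.
  rewrite [X in measurable X](_ : _ = [set x | `|path_at (f x) (dyadic p j) -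
    map_mx ratr (nth 0 q (Num.truncn (2 ^+ m * dyadic p j)))| <= l.+1%:R^-1]); last first.
    by apply/seteqP; split => x //= /(_ isT).
  rewrite -[X in measurable X]setTI; apply: measurable_fun_le => //.
  by apply: measurable_mx_norm; apply: measurable_mxB => //; exact/mf/dyadic_ge0.
- exact: path_box_network.
Qed.

End path_space.

(** * Joint measurability and vector-valued integrals *)

Lemma measurable_truncn_eq (R : realType) (k : nat) :
  measurable [set t : R | Num.truncn t = k].
Proof.
have mlt j : measurable [set t : R | (Num.truncn t <= j)%N].
  rewrite (_ : [set t | _] = `]-oo, j.+1%:R[%classic) //.
  by apply/seteqP; split => t /=; rewrite in_itv /= truncn_le_nat.
case: k => [|k].
  rewrite (_ : [set t | _] = [set t : R | (Num.truncn t <= 0)%N]) //.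
  by apply/seteqP; split => t /=; rewrite leqn0 => /eqP.
rewrite (_ : [set t | _] = [set t : R | (Num.truncn t <= k.+1)%N] `\`
  [set t : R | (Num.truncn t <= k)%N]); first exact: measurableD.
apply/seteqP; split => t /= => [->|[]]; first by rewrite ltnn.
by move=> h /negP; rewrite -ltnNge => h'; apply/eqP; rewrite eqn_leq h.
Qed.

(** Pointwise limit of the evaluations at the dyadic approximations of the
    time.  Each of these is obtained by gluing countably many functions of the
    path alone. *)
Lemma measurable_eval_uncurry (R : realType) (d : nat) :
  measurable_fun setT (fun z : R * cpath R d => path_at z.2 z.1).
Proof.
apply/measurable_mxP => i j.
pose h m (z : R * cpath R d) : R := path_at z.2 (dyadic_floor m z.1) i j.
apply: (measurable_fun_cvg (h := h)) => [m|z _].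
  move=> _ S mS; rewrite setTI.
  rewrite (_ : _ @^-1` _ = \bigcup_k
    (((fun z : R * cpath R d => 2 ^+ m * z.1) @^-1` [set t | Num.truncn t = k]) `&`
     (snd @^-1` ((fun w => path_at w (dyadic R m k) i j) @^-1` S)))).
    apply: bigcupT_measurable => k; apply: measurableI.
      rewrite -[X in measurable X]setTI.
      have : measurable_fun setT (fun z : R * cpath R d => 2 ^+ m * z.1).
        exact: measurable_funM.
      by apply => //; exact: measurable_truncn_eq.
    rewrite -[X in measurable X]setTI; apply: measurable_snd => //.
    have := @measurable_eval R d (dyadic R m k) => /measurable_mxP/(_ i j).
    by move=> /(_ measurableT _ mS); rewrite setTI.
  apply/seteqP; split => [z Sz|z [k _ []]] /=.
    by exists (Num.truncn (2 ^+ m * z.1)) => //; split => //.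
  by rewrite /h /dyadic_floor /= => ->.
have c := @cvg_path_dyadic R d z.2 z.1.
apply: (cvg_comp _ (fun x : 'rV[R]_d => x i j) c); exact: coord_continuous.
Qed.

Section parameter_integral.
Context d1 d2 (T1 : measurableType d1) (T2 : measurableType d2) (R : realType).
Variables (mu : {sigma_finite_measure set T2 -> \bar R}) (D : set T2).
Hypothesis mD : measurable D.

(** Tonelli applied to the positive and negative parts; where both integrals
    are infinite the value is fixed by the conventions of [-] and [fine], which
    are measurable. *)
Lemma measurable_fine_integral (f : T1 * T2 -> R) : measurable_fun setT f ->
  measurable_fun setT (fun x => fine (\int[mu]_(y in D) (f (x, y))%:E)%E).
Proof.
move=> mf.
pose g (z : T1 * T2) := (f z * \1_D z.2)%:E.
have mg : measurable_fun setT g.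
  apply/measurable_EFinP; apply: measurable_funM => //.
  have mi : measurable_fun setT (\1_D : T2 -> R) by exact: measurable_indic.
  exact: (measurableT_comp mi measurable_snd).
rewrite (_ : (fun x => _) = fun x => fine
    ((\int[mu]_y g^\+%E (x, y)) - (\int[mu]_y g^\-%E (x, y)))%E).
  apply: (measurableT_comp (f := fine)); first exact: fine_measurable.
  apply: emeasurable_funB.
    have mgp : measurable_fun setT g^\+%E by exact: measurable_funepos.
    exact: (measurable_fun_fubini_tonelli_F (m2 := mu) _ mgp (fun=> funepos_ge0 _ _)).
  have mgn : measurable_fun setT g^\-%E by exact: measurable_funeneg.
  exact: (measurable_fun_fubini_tonelli_F (m2 := mu) _ mgn (fun=> funeneg_ge0 _ _)).
apply/funext => x; congr fine.
rewrite integral_mkcond (_ : _ \_ D = fun y => g (x, y)).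
  rewrite integralE; congr (_ - _)%E; apply: eq_integral => y _.
    by rewrite !funeposE.
  by rewrite !funenegE.
apply/funext => y; rewrite patchE /g indicE /=.
by case: ifP => yD; rewrite ?mulr1 ?mulr0.
Qed.

Lemma measurable_vintegral (d : nat) (f : T1 * T2 -> 'rV[R]_d) :
  measurable_fun setT f ->
  measurable_fun setT (fun x => vintegral mu D (fun y => f (x, y))).
Proof.
move=> /measurable_mxP mf; apply/measurable_mxP => i j.
by under eq_fun do rewrite mxE; exact: (measurable_fine_integral (mf 0 j)).
Qed.

End parameter_integral.

Section vector_integral.
Context dT (T : measurableType dT) (R : realType) (d : nat).
Variables (mu : {measure set T -> \bar R}) (D : set T).
Hypothesis mD : measurable D.
Implicit Types (f g : T -> 'rV[R]_d) (h : T -> R).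

Lemma vintegrable_dominated f h : measurable_fun D f ->
  mu.-integrable D (EFin \o h) -> (forall x, D x -> `|f x| <= h x) ->
  vintegrable mu D f.
Proof.
move=> mf ih fh k; apply: le_integrable ih => //.
  apply/measurable_EFinP.
  exact: (measurableT_comp (measurable_mx_coord 0 k) mf).
move=> x Dx /=; rewrite lee_fin (le_trans (normr_mx_coord _ _ _)) //.
by rewrite (le_trans (fh _ Dx)) // ler_norm.
Qed.

(** The norm on matrices is the maximum of the entries, so the bound on each
    coordinate gives the bound on the vector with no loss of constant. *)
Lemma normr_vintegral_le f h : vintegrable mu D f ->
  mu.-integrable D (EFin \o h) -> (forall x, D x -> `|f x| <= h x) ->
  `|vintegral mu D f| <= \int[mu]_(x in D) h x.
Proof.
move=> vf ih fh; apply: normr_mx_le => [|i k].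
  by apply: Rintegral_ge0 => x Dx; rewrite (le_trans _ (fh x Dx)).
rewrite (ord1 i) mxE; apply: (le_trans (le_normr_Rintegral _ (vf k))) => //.
apply: le_Rintegral => //; first exact: integrable_norm (vf k).
by move=> x Dx; rewrite (le_trans (normr_mx_coord _ _ _)) // fh.
Qed.

Lemma vintegrableB f g : vintegrable mu D f -> vintegrable mu D g ->
  vintegrable mu D (fun x => f x - g x).
Proof.
move=> vf vg k; under eq_fun do rewrite !mxE EFinB.
exact: integrableB (vf k) (vg k).
Qed.

Lemma vintegralB f g : vintegrable mu D f -> vintegrable mu D g ->
  vintegral mu D (fun x => f x - g x) = vintegral mu D f - vintegral mu D g.
Proof.
move=> vf vg; apply/rowP => k; rewrite !mxE.
by under eq_integral do rewrite !mxE; exact: (RintegralB _ (vf k) (vg k)).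
Qed.

Lemma vintegrableD f g : vintegrable mu D f -> vintegrable mu D g ->
  vintegrable mu D (fun x => f x + g x).
Proof.
move=> vf vg k; under eq_fun do rewrite !mxE EFinD.
exact: integrableD (vf k) (vg k).
Qed.

Lemma vintegralD f g : vintegrable mu D f -> vintegrable mu D g ->
  vintegral mu D (fun x => f x + g x) = vintegral mu D f + vintegral mu D g.
Proof.
move=> vf vg; apply/rowP => k; rewrite !mxE.
by under eq_integral do rewrite !mxE; exact: (RintegralD _ (vf k) (vg k)).
Qed.

Lemma eq_vintegral f g : {in D, f =1 g} -> vintegral mu D f = vintegral mu D g.
Proof.
move=> fg; apply/rowP => k; rewrite !mxE.
by congr fine; apply: eq_integral => x xD; rewrite fg.
Qed.

Lemma eq_vintegrable f g : {in D, f =1 g} -> vintegrable mu D f -> vintegrable mu D g.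
Proof.
move=> fg vf k; apply: eq_integrable (vf k) => // x xD.
by rewrite fg.
Qed.

End vector_integral.

(** * Integrals over time *)

Lemma cvg_mx (T : Type) (F : set_system T) {FF : Filter F} (R : realType) (m n : nat)
    (f : T -> 'M[R]_(m, n)) (l : 'M[R]_(m, n)) :
  (forall i j, f t i j @[t --> F] --> l i j) -> f @ F --> l.
Proof.
move=> fl; apply/cvgrPdist_le => e e0.
have : \forall t \near F, forall i j, `|l i j - f t i j| <= e.
  apply: filter_forall => i; apply: filter_forall => j.
  by have /cvgrPdist_le := fl i j; exact.
apply: filterS => t lt; apply: normr_mx_le => [|i j]; first exact: ltW.
by rewrite !mxE.
Qed.

Section time_integral.
Variable R : realType.
Notation leb := (@lebesgue_measure R).

Lemma continuous_vintegral (d : nat) (f : R -> 'rV[R]_d) :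
  (forall t, 0 <= t -> vintegrable leb `[0, t] f) ->
  continuous (fun t : R => vintegral leb `[0, Num.max 0 t] f).
Proof.
move=> vf t0; apply: cvg_mx => i k; rewrite mxE; under eq_fun do rewrite mxE.
have m0 (t : R) : 0 <= Num.max 0 t by rewrite le_max lexx.
pose b : R := Num.max 0 t0 + 1.
have b0 : 0 <= b by rewrite addr_ge0.
have := parameterized_integral_continuous b0 (vf b b0 k).
move/subspace_continuousP => /(_ (Num.max 0 t0)).
rewrite /= in_itv /= m0 lerDl ler01 => /(_ isT) c.
have cm : (fun t : R => Num.max 0 t) @ t0 --> Num.max 0 t0.
  by apply: continuous_max; [exact: cvg_cst|exact: cvg_id].
move=> U /c /= cU; have : \forall t \near t0, Num.max 0 t < b.
  by have /cvgr_lt := cm; apply; rewrite ltrDl.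
have {}cU : nbhs (Num.max 0 t0)
    [set x | `[0, b]%classic x -> U (\int[leb]_(s in `[0, x]) f s 0 k)] by exact: cU.
move=> tb; have := cm _ cU; apply: filterS2 tb => t /= tb tU.
by apply: tU; rewrite in_itv /= m0 ltW.
Qed.

Lemma integrable_cst_itv (a t : R) : leb.-integrable `[0, t] (EFin \o cst a).
Proof.
apply: continuous_compact_integrable; first exact: segment_compact.
by apply: continuous_subspaceT => x; exact: cvg_cst.
Qed.

Lemma Rintegral_cst_itv (a t : R) : 0 <= t -> \int[leb]_(s in `[0, t]) a = a * t.
Proof.
move=> t0; rewrite Rintegral_cst //; congr (_ * _).
have -> : fine (leb `[0, t]) = fine (if (0 < t)%R then t%:E - 0%:E else 0)%E.
  by rewrite lebesgue_measure_itv /= lte_fin.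
by case: ltgtP t0 => [//| |<-] //=; rewrite subr0.
Qed.

Lemma integrable_expR_itv (c lam t : R) :
  leb.-integrable `[0, t] (EFin \o (fun s => c * expR (lam * s))).
Proof.
apply: continuous_compact_integrable; first exact: segment_compact.
apply: continuous_subspaceT => x.
apply: cvgM; first exact: cvg_cst.
apply: continuous_comp; last exact: continuous_expR.
by apply: cvgM; [exact: cvg_cst|exact: cvg_id].
Qed.

Lemma Rintegral_expR_le (c lam t : R) : 0 <= c -> 0 < lam -> 0 <= t ->
  \int[leb]_(s in `[0, t]) (c * expR (lam * s)) <= c / lam * expR (lam * t).
Proof.
move=> c0 lam0; rewrite le_eqVlt => /predU1P[<-|t0].
  by rewrite set_itv1 Rintegral_set1 mulr_ge0 ?expR_ge0 // divr_ge0 // ltW.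
pose F s := c / lam * expR (lam * s).
have dF (s : R) : is_derive s (1 : R) F (c * expR (lam * s)).
  rewrite /F; apply: is_derive_eq; rewrite /GRing.scale /=.
  by field; rewrite gt_eqF.
rewrite /Rintegral (@continuous_FTC2 _ _ F) //.
- by rewrite -EFinB /= lerBlDr lerDl mulr_ge0 ?expR_ge0 // divr_ge0 // ltW.
- apply: continuous_subspaceT => x.
  apply: cvgM; first exact: cvg_cst.
  apply: continuous_comp; last exact: continuous_expR.
  by apply: cvgM; [exact: cvg_cst|exact: cvg_id].
- have cF (s : R) : {for s, continuous F}.
    by apply: differentiable_continuous; apply/derivable1_diffP.
  split => //.
  + by apply: cvg_at_right_filter; exact: cF.
  + by apply: cvg_at_left_filter; exact: cF.
- by move=> s _; rewrite derive1E derive_val.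
Qed.

(** Integrating a bound [c * expR (lam * s)] divides the constant by [lam].
    Taking [lam] large is what makes the fixed point and uniqueness arguments
    contract on time intervals of any length. *)
Lemma normr_vintegral_expR (d : nat) (f : R -> 'rV[R]_d) (c lam t : R) :
  0 <= c -> 0 < lam -> 0 <= t -> vintegrable leb `[0, t] f ->
  (forall s, 0 <= s <= t -> `|f s| <= c * expR (lam * s)) ->
  `|vintegral leb `[0, t] f| <= c / lam * expR (lam * t).
Proof.
move=> c0 lam0 t0 vf fc; apply: le_trans (Rintegral_expR_le c0 lam0 t0).
apply: normr_vintegral_le => //; first exact: integrable_expR_itv.
Qed.

End time_integral.

(** * Lipschitz kernels and processes with locally bounded mean *)

Section kernel.
Context (R : realType) (d : nat).
Variables (K : 'rV[R]_d * 'rV[R]_d -> 'rV[R]_d) (L : R).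
Hypothesis L0 : 0 < L.
Hypothesis KL : forall y x y' x', `|K (y, x) - K (y', x')| <= L * (`|y - y'| + `|x - x'|).

(** A continuous map between matrix spaces is Borel; concatenating the two
    arguments of [K] into one row vector replaces the product by such a
    space. *)
Lemma measurable_kernel dT (T : measurableType dT) (f g : T -> 'rV[R]_d) :
  measurable_fun setT f -> measurable_fun setT g ->
  measurable_fun setT (fun t => K (f t, g t)).
Proof.
move=> mf mg.
pose k (z : 'rV[R]_(d + d)) := K (lsubmx z, rsubmx z).
have -> : (fun t => K (f t, g t)) = k \o (fun t => row_mx (f t) (g t)).
  by apply/funext => t; rewrite /k /= row_mxKl row_mxKr.
apply: measurableT_comp; last first.
  apply/measurable_mxP => i j; rewrite (ord1 i).
  have [k' ->|k' ->] := split_ordP j.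
    by under eq_fun do rewrite row_mxEl; exact: ((measurable_mxP _).1 mf).
  by under eq_fun do rewrite row_mxEr; exact: ((measurable_mxP _).1 mg).
apply: measurable_mx_continuous => z.
apply/(@cvgrPdist_lt _ _ _ _ (nbhs_filter (z : 'rV[R]_(d + d)))) => e e0.
have e1 : 0 < e / (2 * L) by rewrite divr_gt0 // mulr_gt0.
have := nbhsx_ballx z _ e1; apply: filterS => z'; rewrite -ball_normE /= => zz'.
apply: (le_lt_trans (KL _ _ _ _)).
have hl : `|lsubmx z - lsubmx z'| <= `|z - z'|.
  by apply: normr_mx_le => // i j; rewrite -linearB /= [X in `|X|]mxE; exact: normr_mx_coord.
have hr : `|rsubmx z - rsubmx z'| <= `|z - z'|.
  by apply: normr_mx_le => // i j; rewrite -linearB /= [X in `|X|]mxE; exact: normr_mx_coord.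
rewrite mulrC -ltr_pdivlMr // (le_lt_trans (lerD hl hr)) //.
by rewrite -mulr2n -mulr_natl -ltr_pdivlMl // mulrC -mulrA -invfM [L * _]mulrC.
Qed.

Lemma kernel_growth y x : `|K (y, x)| <= `|K (0, 0)| + L * (`|y| + `|x|).
Proof.
have := KL y x 0 0; rewrite !subr0 => h.
rewrite -[K (y, x)](subrK (K (0, 0))) (le_trans (ler_normD _ _)) //.
by rewrite [leRHS]addrC lerD2r.
Qed.

End kernel.

Section process.
Context (R : realType) (d : nat) dT (T : measurableType dT).
Implicit Types X : T -> cpath R d.

Lemma measurable_process X : measurable_fun setT X ->
  measurable_fun setT (fun z : R * T => path_at (X z.2) z.1).
Proof.
move=> mX.
have m1 : measurable_fun setT (fun z : R * T => X z.2).
  exact: (measurableT_comp mX measurable_snd).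
have m2 : measurable_fun setT (fun z : R * T => (z.1, X z.2)).
  exact: (measurable_fun_pair measurable_fst m1).
exact: (measurableT_comp (@measurable_eval_uncurry R d) m2).
Qed.

Lemma measurable_at X t : measurable_fun setT X ->
  measurable_fun setT (fun w => path_at (X w) t).
Proof. exact: (measurableT_comp (measurable_eval t)). Qed.

End process.

Section locally_L1.
Context (R : realType) (d : nat) dT (T : measurableType dT) (mu : probability T R).
Implicit Types X : T -> cpath R d.
Notation leb := (@lebesgue_measure R).

(** The class in which the fixed point is sought; every solution turns out to
    belong to it. *)
Definition locally_L1 X := forall t0, exists c : R, 0 <= c /\ forall t, 0 <= t <= t0 ->
  (\int[mu]_w `|path_at (X w) t|%:E <= c%:E)%E.

Lemma locally_L1_integrable X t : measurable_fun setT X -> locally_L1 X -> 0 <= t ->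
  mu.-integrable setT (EFin \o (fun w => `|path_at (X w) t|)).
Proof.
move=> mX /(_ t)[c [_ ct]] t0; apply/integrableP; split.
  by apply/measurable_EFinP; apply: measurable_mx_norm; exact: measurable_at.
under eq_integral do rewrite /= normr_id.
by rewrite (le_lt_trans (ct t _)) ?ltry // lexx andbT.
Qed.

Lemma locally_L1_le X t c : measurable_fun setT X -> locally_L1 X -> 0 <= t ->
  (\int[mu]_w `|path_at (X w) t|%:E <= c%:E)%E <-> \int[mu]_w `|path_at (X w) t| <= c.
Proof.
move=> mX X1 t0; have iX := locally_L1_integrable mX X1 t0.
by rewrite -lee_fin /Rintegral fineK //; exact: integrable_fin_num iX.
Qed.

(** A pathwise quantity whose mean is controlled by the means at fixed times
    ([integral_time_norm_le]); it plays the role usually given to the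
    running maximum, with Tonelli in place of a maximal inequality. *)
Definition time_norm t (x : cpath R d) : R := \int[leb]_(s in `[0, t]) `|path_at x s|.

Lemma time_norm_integrable t (x : cpath R d) :
  leb.-integrable `[0, t] (EFin \o (fun s => `|path_at x s|)).
Proof.
apply: continuous_compact_integrable; first exact: segment_compact.
by apply: continuous_subspaceT => s; apply: cvg_norm; exact: path_at_continuous.
Qed.

Lemma time_norm_le s t (x : cpath R d) : s <= t -> time_norm s x <= time_norm t x.
Proof.
move=> st; rewrite /time_norm /Rintegral fine_le //.
- exact: integrable_fin_num (time_norm_integrable _ _).
- exact: integrable_fin_num (time_norm_integrable _ _).
apply: ge0_subset_integral => //.
- by apply: (measurable_int leb); exact: time_norm_integrable.
- by apply: subset_itvl; rewrite bnd_simp.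
Qed.

Lemma time_norm_ge0 t x : 0 <= time_norm t x.
Proof. by apply: Rintegral_ge0 => s _. Qed.

Lemma measurable_time_norm X t : measurable_fun setT X ->
  measurable_fun setT (fun w => time_norm t (X w)).
Proof.
move=> mX.
apply: (@measurable_fine_integral _ _ _ _ _ leb _ _
  (fun z : T * R => `|path_at (X z.1) z.2|)) => //.
apply: measurable_mx_norm.
exact: (measurableT_comp (measurable_process mX) (@measurable_swap _ _ T R)).
Qed.

Lemma integral_time_norm_le X t c : measurable_fun setT X -> 0 <= t ->
  (forall s, 0 <= s <= t -> (\int[mu]_w `|path_at (X w) s|%:E <= c%:E)%E) ->
  (\int[mu]_w (time_norm t (X w))%:E <= (c * t)%:E)%E.
Proof.
move=> mX t0 Xc.
pose f (z : T * R) := (`|path_at (X z.1) z.2| * \1_(`[0, t]%classic : set R) z.2)%:E.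
have mf : measurable_fun setT f.
  apply/measurable_EFinP; apply: measurable_funM.
    apply: measurable_mx_norm.
    exact: (measurableT_comp (measurable_process mX) (@measurable_swap _ _ T R)).
  have mi : measurable_fun setT (\1_(`[0, t]%classic : set R) : R -> R).
    exact: measurable_indic.
  exact: (measurableT_comp mi measurable_snd).
have f0 z : (0 <= f z)%E by rewrite lee_fin mulr_ge0.
rewrite (_ : \int[mu]_w _ = \int[mu]_w \int[leb]_s f (w, s))%E; last first.
  apply: eq_integral => w _.
  rewrite /time_norm /Rintegral fineK; last exact: integrable_fin_num (time_norm_integrable _ _).
  rewrite integral_mkcond; apply: eq_integral => s _; rewrite patchE /f indicE /=.
  by case: ifP => _; rewrite ?mulr1 ?mulr0.
rewrite (fubini_tonelli (m1 := mu) (m2 := leb) f) //.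
rewrite -(Rintegral_cst_itv c t0) /Rintegral fineK; last first.
  exact: integrable_fin_num (integrable_cst_itv c t).
rewrite [leRHS]integral_mkcond; apply: ge0_le_integral => //.
- by move=> s _; apply: integral_ge0.
- exact: measurable_fun_fubini_tonelli_G.
- by apply/(measurable_restrictT _ _).1.
- move=> s _; rewrite patchE; case: ifPn => [|sN].
    rewrite inE /= in_itv /= => st; apply: le_trans (Xc s st).
    apply: ge0_le_integral => // [||w _].
    + exact: (measurableT_comp mf (@pair2_measurable _ _ T R s)).
    + by apply/measurable_EFinP; apply: measurable_mx_norm; exact: measurable_at.
    + by rewrite lee_fin ler_piMr // indicE lern1 leq_b1.
  by rewrite (eq_integral (cst 0%E)) ?integral0 // => w _; rewrite /f /= indicE (negbTE sN) mulr0.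
Qed.

End locally_L1.

(** * The mean-field drift *)

Section integral_bound.
Context (R : realType) dT (T : measurableType dT) (mu : {measure set T -> \bar R}).
Variable D : set T.
Hypothesis mD : measurable D.
Implicit Types f g : T -> R.

Lemma integrableDE f g : mu.-integrable D (EFin \o f) -> mu.-integrable D (EFin \o g) ->
  mu.-integrable D (EFin \o (fun w => f w + g w)).
Proof.
by move=> fi gi; apply: eq_integrable (integrableD mD fi gi).
Qed.

Lemma integrableZE (c : R) f : mu.-integrable D (EFin \o f) ->
  mu.-integrable D (EFin \o (fun w => c * f w)).
Proof.
by move=> fi; apply: eq_integrable (integrableZl mD c fi).
Qed.

End integral_bound.

Section probability_constant.
Context (R : realType) dT (T : measurableType dT) (mu : probability T R).

Lemma Rintegral_cstT (a : R) : \int[mu]_w a = a.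
Proof.
rewrite Rintegral_cst // [X in fine X](_ : _ = 1%E) ?mulr1 //.
exact: (probability_setT mu).
Qed.

Lemma integral_cstT (a : \bar R) : (\int[mu]_w a = a)%E.
Proof.
rewrite integral_cst // [X in (_ * X)%E](_ : _ = 1%E) ?mule1 //.
exact: (probability_setT mu).
Qed.

Lemma integrable_cstT (a : R) : mu.-integrable setT (EFin \o (fun=> a)).
Proof. exact: finite_measure_integrable_cst. Qed.

End probability_constant.

Section mean_field_drift.
Context (R : realType) (d : nat) dT (T : measurableType dT) (mu : probability T R).
Variables (K : 'rV[R]_d * 'rV[R]_d -> 'rV[R]_d) (L : R).
Hypothesis L0 : 0 < L.
Hypothesis KL : forall y x y' x', `|K (y, x) - K (y', x')| <= L * (`|y - y'| + `|x - x'|).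
Notation leb := (@lebesgue_measure R).
Notation K0 := `|K (0, 0)|.
Implicit Types X : T -> cpath R d.

Definition mf_drift X (s : R) (y : 'rV[R]_d) : 'rV[R]_d :=
  vintegral mu setT (fun w => K (y, path_at (X w) s)).

Section one_process.
Variable X : T -> cpath R d.
Hypotheses (mX : measurable_fun setT X) (X1 : locally_L1 mu X).

Lemma vintegrable_kernel s y : 0 <= s ->
  vintegrable mu setT (fun w => K (y, path_at (X w) s)).
Proof.
move=> s0; have iX := locally_L1_integrable mX X1 s0.
apply: (@vintegrable_dominated _ _ _ _ _ _ measurableT _
    (fun w => (K0 + L * `|y|) + L * `|path_at (X w) s|)).
- by apply: (measurable_kernel L0 KL) => //; exact: measurable_at.
- exact: (integrableDE measurableT) (integrable_cstT _ _) (integrableZE measurableT _ iX).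
- by move=> w _; rewrite (le_trans (kernel_growth KL _ _)) // mulrDr addrA.
Qed.

Lemma mf_drift_growth s y c : 0 <= s ->
  (\int[mu]_w `|path_at (X w) s|%:E <= c%:E)%E ->
  `|mf_drift X s y| <= K0 + L * (`|y| + c).
Proof.
move=> s0 /(locally_L1_le _ mX X1 s0) Xc.
have iX := locally_L1_integrable mX X1 s0.
apply: (@le_trans _ _ (\int[mu]_w ((K0 + L * `|y|) + L * `|path_at (X w) s|))).
  apply: normr_vintegral_le => //; first exact: vintegrable_kernel.
    exact: (integrableDE measurableT) (integrable_cstT _ _) (integrableZE measurableT _ iX).
  by move=> w _; rewrite (le_trans (kernel_growth KL _ _)) // mulrDr addrA.
rewrite RintegralD //; [|exact: integrable_cstT|exact: integrableZE].
rewrite Rintegral_cstT RintegralZl // mulrDr addrA lerD2l.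
by rewrite ler_wpM2l // ltW.
Qed.

Lemma measurable_mf_drift dS (S : measurableType dS) (Z : S -> cpath R d) :
  measurable_fun setT Z ->
  measurable_fun setT (fun z : R * S => mf_drift X z.1 (path_at (Z z.2) z.1)).
Proof.
move=> mZ.
apply: (@measurable_vintegral _ _ _ _ _ mu _ measurableT _
  (fun z : (R * S) * T => K (path_at (Z z.1.2) z.1.1, path_at (X z.2) z.1.1))).
apply: (measurable_kernel L0 KL).
  exact: (measurableT_comp (measurable_process mZ) measurable_fst).
have m1 : measurable_fun setT (fun z : (R * S) * T => z.1.1).
  exact: (measurableT_comp measurable_fst measurable_fst).
have m2 : measurable_fun setT (fun z : (R * S) * T => (z.1.1, z.2)).
  exact: measurable_fun_pair.
exact: (measurableT_comp (measurable_process mX) m2).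
Qed.

Lemma measurable_mf_drift_path (x : cpath R d) :
  measurable_fun setT (fun s => mf_drift X s (path_at x s)).
Proof.
have := @measurable_mf_drift _ (cpath R d) (fun=> x) (measurable_cst _).
by move=> h; exact: (measurableT_comp h (pair2_measurable x)).
Qed.

Lemma vintegrable_mf_drift t (x : cpath R d) : 0 <= t ->
  vintegrable leb `[0, t] (fun s => mf_drift X s (path_at x s)).
Proof.
move=> t0; have [c [c0 Xc]] := X1 t.
apply: (@vintegrable_dominated _ _ _ _ leb _ (measurable_itv _) _
    (fun s => (K0 + L * c) + L * `|path_at x s|)).
- by apply: measurable_funTS; exact: measurable_mf_drift_path.
- apply: integrableDE => //; first exact: integrable_cst_itv.
  by apply: integrableZE => //; exact: time_norm_integrable.
- move=> s; rewrite /= in_itv /= => st; have /andP[s0 _] := st.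
  by rewrite (le_trans (mf_drift_growth _ s0 (Xc s st))) // mulrDr -addrA lerD2l addrC.
Qed.

Lemma normr_vintegral_mf_drift t c (x : cpath R d) : 0 <= t ->
  (forall s, 0 <= s <= t -> (\int[mu]_w `|path_at (X w) s|%:E <= c%:E)%E) ->
  `|vintegral leb `[0, t] (fun s => mf_drift X s (path_at x s))| <=
  (K0 + L * c) * t + L * time_norm t x.
Proof.
move=> t0 Xc.
apply: (@le_trans _ _ (\int[leb]_(s in `[0, t]) ((K0 + L * c) + L * `|path_at x s|))).
  apply: normr_vintegral_le => //; first exact: vintegrable_mf_drift.
    apply: integrableDE => //; first exact: integrable_cst_itv.
    by apply: integrableZE => //; exact: time_norm_integrable.
  move=> s; rewrite /= in_itv /= => st; have /andP[s0 _] := st.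
  by rewrite (le_trans (mf_drift_growth _ s0 (Xc s st))) // mulrDr -addrA lerD2l addrC.
rewrite RintegralD //; [|exact: integrable_cst_itv|]; last first.
  by apply: integrableZE => //; exact: time_norm_integrable.
rewrite Rintegral_cst_itv // RintegralZl //; exact: time_norm_integrable.
Qed.

End one_process.

(** The two laws are compared through the coupling of [X] and [X'] that the
    common probability space provides. *)
Lemma mf_drift_dist X X' s y y' h : 0 <= s ->
  measurable_fun setT X -> locally_L1 mu X ->
  measurable_fun setT X' -> locally_L1 mu X' ->
  mu.-integrable setT (EFin \o h) ->
  (forall w, `|path_at (X w) s - path_at (X' w) s| <= h w) ->
  `|mf_drift X s y - mf_drift X' s y'| <= L * (`|y - y'| + \int[mu]_w h w).
Proof.
move=> s0 mX X1 mX' X'1 ih Xh.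
have vX := vintegrable_kernel mX X1 y s0.
have vX' := vintegrable_kernel mX' X'1 y' s0.
rewrite /mf_drift -vintegralB //.
apply: (@le_trans _ _ (\int[mu]_w (L * `|y - y'| + L * h w))).
  apply: normr_vintegral_le => //; first exact: vintegrableB.
    exact: (integrableDE measurableT) (integrable_cstT _ _) (integrableZE measurableT _ ih).
  move=> w _; rewrite (le_trans (KL _ _ _ _)) // mulrDr lerD2l.
  by rewrite ler_wpM2l // ltW.
rewrite RintegralD //; [|exact: integrable_cstT|exact: integrableZE].
by rewrite Rintegral_cstT RintegralZl // mulrDr.
Qed.

End mean_field_drift.

Section drive.
Context (R : realType) (d : nat).
Notation leb := (@lebesgue_measure R).

Definition drive (g : R -> 'rV[R]_d) (x : cpath R d) : cpath R d :=
  path_of (fun t => path_at x t + vintegral leb `[0, t] g).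

Lemma driveE g x t : (forall t, 0 <= t -> vintegrable leb `[0, t] g) -> 0 <= t ->
  path_at (drive g x) t = path_at x t + vintegral leb `[0, t] g.
Proof.
move=> vg t0; rewrite path_ofE // => s.
apply: cvgD; last exact: continuous_vintegral.
under eq_fun do rewrite path_at_max0; rewrite path_at_max0.
exact: path_at_continuous.
Qed.

End drive.

(** * The solution map *)

(** A Cauchy criterion with an explicit rate, applied below to the values of
    the Picard iterates at a fixed time. *)
Lemma geometric_cvg (R : realType) (d : nat) (u : nat -> 'rV[R]_d) (c : R) :
  (forall k, `|u k.+1 - u k| <= c / 2 ^+ k) ->
  cvgn u /\ forall k, `|limn u - u k| <= 2 * c / 2 ^+ k.
Proof.
move=> uc.
have c0 : 0 <= c by have := uc 0%N; rewrite expr0 divr1; exact: le_trans.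
have ujk k j : `|u (k + j)%N - u k| <= 2 * c / 2 ^+ k - 2 * c / 2 ^+ (k + j).
  elim: j => [|j IH]; first by rewrite addn0 !subrr normr0.
  rewrite addnS -(subrKA (u (k + j)%N)) (le_trans (ler_normD _ _)) //.
  apply: (le_trans (lerD (uc _) IH)); rewrite exprS.
  rewrite [_ / (2 * _)](_ : _ = c / 2 ^+ (k + j)); last first.
    by field; rewrite expf_neq0.
  by lra.
have ujk' k j : (k <= j)%N -> `|u j - u k| <= 2 * c / 2 ^+ k.
  move=> /subnKC <-; apply: (le_trans (ujk _ _)).
  by rewrite lerBlDr lerDl !mulr_ge0 // invr_ge0 exprn_ge0.
have cu : cvgn u.
  apply/cauchy_cvgP/cauchy_exP => e e0.
  have e2 : 0 < e / (2 * c + 1) by rewrite divr_gt0 // ltr_wpDl ?mulr_ge0.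
  have [k _ /(_ k (leqnn k)) /= ke] := near_infty_natSinv_expn_lt (PosNum e2).
  exists (u k); exists k => // j /= kj.
  rewrite -ball_normE /= distrC (le_lt_trans (ujk' _ _ kj)) //.
  move: ke; rewrite ltr_pdivlMr ?ltr_wpDl ?mulr_ge0 // div1r.
  have : 0 < (2 ^+ k)^-1 :> R by rewrite invr_gt0 exprn_gt0.
  by set a := (2 ^+ k)^-1; lra.
split=> // k.
have cv : `|u j - u k| @[j --> \oo] --> `|limn u - u k|.
  by apply: cvg_norm; apply: cvgB; [exact: cu|exact: cvg_cst].
apply: (cvgr_to_le cv); exists k => // j /=; exact: ujk'.
Qed.

Lemma le0_geometric (R : realType) (a c : R) : (forall k, a <= c / 2 ^+ k) -> a <= 0.
Proof.
move=> ac; rewrite leNgt; apply/negP => a0.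
have c0 : 0 < c by have := ac 0%N; rewrite expr0 divr1; exact: lt_le_trans.
have e0 : 0 < a / c by rewrite divr_gt0.
have [k _ /(_ k (leqnn k)) /= ke] := near_infty_natSinv_expn_lt (PosNum e0).
have := ac k; rewrite leNgt => /negP; apply.
by move: ke; rewrite ltr_pdivlMr // div1r mulrC.
Qed.

Section picard.
Context (R : realType) (d : nat) (nu : probability (cpath R d) R).
Variables (K : 'rV[R]_d * 'rV[R]_d -> 'rV[R]_d) (L : R).
Hypothesis L0 : 0 < L.
Hypothesis KL : forall y x y' x', `|K (y, x) - K (y', x')| <= L * (`|y - y'| + `|x - x'|).
Hypothesis nu1 : locally_L1 nu (@idfun (cpath R d)).
Notation leb := (@lebesgue_measure R).
Notation K0 := `|K (0, 0)|.
(* The weight that makes the iteration contract by [1 / 2]; see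
   [picard_contraction]. *)
Notation lam := (6 * L).
Implicit Types F G : cpath R d -> cpath R d.

Definition admissible F := measurable_fun setT F /\ locally_L1 nu F.

(** The drift seen along [F x] when the law of the particle is the image of
    [nu] under [F]. *)
Definition path_drift F x s := mf_drift nu K F s (path_at (F x) s).

(** The iteration is specified by its values alone; [picardE] is all that is
    used of it. *)
Lemma picard_exists : exists P : (cpath R d -> cpath R d) -> cpath R d -> cpath R d,
  forall F x t, admissible F -> 0 <= t ->
  path_at (P F x) t = path_at x t + vintegral leb `[0, t] (path_drift F x).
Proof.
exists (fun F x => drive (path_drift F x) x) => F x t [mF F1] t0.
by apply: driveE => // s s0; exact: (vintegrable_mf_drift L0 KL mF F1).
Qed.

Definition picard := sval (cid picard_exists).

Lemma picardE F x t : admissible F -> 0 <= t ->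
  path_at (picard F x) t = path_at x t + vintegral leb `[0, t] (path_drift F x).
Proof. exact: (svalP (cid picard_exists)). Qed.

Lemma measurable_picard F : admissible F -> measurable_fun setT (picard F).
Proof.
move=> aF; have [mF F1] := aF; apply/measurable_cpathP => t t0.
under eq_fun do rewrite picardE //.
apply: measurable_mxD; first exact: measurable_eval.
apply: (@measurable_vintegral _ _ _ _ _ leb _ (measurable_itv _) _
  (fun z : cpath R d * R => path_drift F z.1 z.2)).
have h := measurableT_comp (measurable_mf_drift nu L0 KL mF mF)
  (@measurable_swap _ _ (cpath R d) R).
exact: h.
Qed.

(** Taking means in the growth bound of the drift. *)
Lemma admissible_picard F : admissible F -> admissible (picard F).
Proof.
move=> aF; have [mF F1] := aF; split; first exact: measurable_picard.
move=> t0; have [a [a0 xa]] := nu1 t0; have [c [c0 Fc]] := F1 t0.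
exists (a + ((K0 + L * c) * `|t0| + L * (c * `|t0|))); split.
  by rewrite !(addr_ge0, mulr_ge0) // ltW.
move=> t /andP[t_ge0 tt0].
have Fct s : 0 <= s <= t -> (\int[nu]_w `|path_at (F w) s|%:E <= c%:E)%E.
  by move=> /andP[s0 st]; apply: Fc; rewrite s0 (le_trans st).
have mid : measurable_fun setT (fun x : cpath R d => `|path_at x t|).
  by apply: measurable_mx_norm; exact: measurable_eval.
have mtn : measurable_fun setT (fun x => time_norm t (F x)) by exact: measurable_time_norm.
apply: (@le_trans _ _ (\int[nu]_x (`|path_at x t|%:E +
   (((K0 + L * c) * t)%:E + L%:E * (time_norm t (F x))%:E)))%E).
  apply: ge0_le_integral => //.
  - by apply/measurable_EFinP; apply: measurable_mx_norm; apply: measurable_at; exact: measurable_picard.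
  - apply: emeasurable_funD; first exact/measurable_EFinP.
    apply: emeasurable_funD => //; apply: emeasurable_funM => //; exact/measurable_EFinP.
  move=> x _; rewrite -EFinM -!EFinD lee_fin picardE // (le_trans (ler_normD _ _)) //.
  by rewrite lerD2l; exact: (normr_vintegral_mf_drift L0 KL mF F1).
have ct0 : 0 <= (K0 + L * c) * t by rewrite !(mulr_ge0, addr_ge0) // ltW.
rewrite ge0_integralD //; last 3 first.
- exact/measurable_EFinP.
- move=> x _; rewrite -EFinM -EFinD lee_fin addr_ge0 // mulr_ge0 ?time_norm_ge0 //; exact: ltW.
- by apply: emeasurable_funD => //; apply: emeasurable_funM => //; exact/measurable_EFinP.
rewrite ge0_integralD //; last 2 first.
- by move=> x _; rewrite -EFinM lee_fin mulr_ge0 ?time_norm_ge0 //; exact: ltW.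
- by apply: emeasurable_funM => //; exact/measurable_EFinP.
rewrite ge0_integralZl //; last 3 first.
- exact/measurable_EFinP.
- by move=> x _; rewrite lee_fin time_norm_ge0.
- by rewrite lee_fin ltW.
rewrite !EFinD; apply: leeD; first by apply: xa; rewrite t_ge0.
have tt : t <= `|t0| by rewrite (le_trans tt0) // ler_norm.
apply: leeD.
  rewrite integral_cstT lee_fin ler_wpM2l // addr_ge0 //.
  by rewrite mulr_ge0 // ltW.
rewrite EFinM lee_pmul2l //; apply: (le_trans (integral_time_norm_le mF t_ge0 Fct)).
by rewrite lee_fin ler_wpM2l.
Qed.

Section contraction.
Variables (F G : cpath R d -> cpath R d) (t0 : R) (m : cpath R d -> R).
Hypotheses (aF : admissible F) (aG : admissible G).
Hypothesis im : nu.-integrable setT (EFin \o m).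
Hypothesis m0 : forall x, 0 <= m x.
Hypothesis Em : forall x, \int[nu]_w m w <= 2 * m x.
Hypothesis FG : forall x s, 0 <= s <= t0 ->
  `|path_at (F x) s - path_at (G x) s| <= m x * expR (lam * s).

(** The hypothesis [Em] says that the mean of the majorant is at most twice any of
    its values, so it lets a bound on the law be absorbed into a pathwise one:
    the difference of the drifts is at most
    [L * (m x + 2 * m x) * expR (lam * s)], and integrating divides by
    [lam = 6 * L]. *)
Lemma picard_contraction x t : 0 <= t <= t0 ->
  `|path_at (picard F x) t - path_at (picard G x) t| <= m x / 2 * expR (lam * t).
Proof.
move=> /andP[t_ge0 tt0]; have [mF F1] := aF; have [mG G1] := aG.
rewrite (picardE x aF t_ge0) (picardE x aG t_ge0) opprD addrACA subrr add0r.
have vF : vintegrable leb `[0, t] (path_drift F x) by exact: (vintegrable_mf_drift L0 KL).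
have vG : vintegrable leb `[0, t] (path_drift G x) by exact: (vintegrable_mf_drift L0 KL).
rewrite -vintegralB //.
(* [3 = 1 + 2]: the position and the mean of the majorant. *)
have -> : m x / 2 = (3 * L * m x) / lam by field; rewrite gt_eqF.
apply: normr_vintegral_expR => //; [by rewrite !mulr_ge0 // ltW|by rewrite mulr_gt0| |].
  exact: vintegrableB.
move=> s /andP[s0 st]; have st0 : 0 <= s <= t0 by rewrite s0 (le_trans st).
have ime : nu.-integrable setT (EFin \o (fun w => expR (lam * s) * m w)).
  exact: integrableZE.
apply: (le_trans (mf_drift_dist L0 KL (h := fun w => expR (lam * s) * m w) _ _ s0 mF F1 mG G1 ime _)).
  by move=> w; rewrite mulrC; exact: FG.
rewrite RintegralZl //; set e := expR (lam * s).
have -> : 3 * L * m x * e = L * (3 * m x * e) by ring.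
rewrite ler_wpM2l ?(ltW L0) //.
have h1 := FG x st0; have h2 := ler_wpM2l (expR_ge0 (lam * s)) (Em x).
by move: h1 h2; rewrite -/e; lra.
Qed.

End contraction.

Definition picard_iter k := iter k picard (@idfun (cpath R d)).

Lemma admissible_iter k : admissible (picard_iter k).
Proof.
elim: k => [|k IH] /=; last exact: admissible_picard.
by split => //; exact: measurable_id.
Qed.

(** The first step is at most [m x = a + L * time_norm t0 x], where the constant
    [a] is chosen so large that the mean of [m] is at most [2 * a].  Each
    further step gains a factor [1 / 2]. *)
Lemma picard_majorant t0 : 0 <= t0 -> exists m : cpath R d -> R,
  [/\ nu.-integrable setT (EFin \o m), (forall x, 0 <= m x),
      (forall x, \int[nu]_w m w <= 2 * m x) &
      forall k x s, 0 <= s <= t0 ->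
        `|path_at (picard_iter k.+1 x) s - path_at (picard_iter k x) s| <=
          m x / 2 ^+ k * expR (lam * s)].
Proof.
move=> t0_ge0; have [c [c0 xc]] := nu1 t0.
have [mid id1] := admissible_iter 0.
pose a := (K0 + L * c) * t0 + L * (c * t0).
have a0 : 0 <= a by rewrite !(addr_ge0, mulr_ge0) // ltW.
have mtn : measurable_fun setT (@time_norm R d t0) by exact: measurable_time_norm mid.
have tn_int : nu.-integrable setT (EFin \o @time_norm R d t0).
  apply/integrableP; split; first exact/measurable_EFinP.
  under eq_integral do rewrite /= ger0_norm ?time_norm_ge0 //.
  by rewrite (le_lt_trans (integral_time_norm_le mid t0_ge0 xc)) // ltry.
have tn_le : \int[nu]_x time_norm t0 x <= c * t0.
  rewrite -lee_fin /Rintegral fineK; last exact: integrable_fin_num tn_int.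
  exact: (integral_time_norm_le mid t0_ge0 xc).
pose m (x : cpath R d) : R := a + L * time_norm t0 x.
have m_ge x : a <= m x by rewrite lerDl mulr_ge0 ?time_norm_ge0 // ltW.
have m0 x : 0 <= m x by rewrite (le_trans a0).
have im : nu.-integrable setT (EFin \o m).
  by apply: integrableDE => //; [exact: integrable_cstT|exact: integrableZE].
have Em x : \int[nu]_w m w <= 2 * m x.
  rewrite RintegralD //; [|exact: integrable_cstT|exact: integrableZE].
  rewrite Rintegral_cstT RintegralZl //; apply: (@le_trans _ _ (2 * a)); last first.
    by rewrite ler_wpM2l.
  rewrite mulr2n mulrDl mul1r lerD2l (le_trans (ler_wpM2l (ltW L0) tn_le)) // lerDr.
  by rewrite mulr_ge0 // addr_ge0 // mulr_ge0 // ltW.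
exists m; split=> //; elim=> [|k IH] x s st.
  have /andP[s0 st0] := st.
  rewrite expr0 divr1 /= picardE //.
  rewrite addrAC subrr add0r.
  have xcs r : 0 <= r <= s -> (\int[nu]_w `|path_at w r|%:E <= c%:E)%E.
    by move=> /andP[r0 rs]; apply: xc; rewrite r0 (le_trans rs).
  apply: (le_trans (normr_vintegral_mf_drift L0 KL mid id1 x s0 xcs)).
  have e1 : 1 <= expR (lam * s) by rewrite -expR0 ler_expR !mulr_ge0 // ltW.
  apply: (@le_trans _ _ (m x)); last by rewrite ler_peMr.
  apply: lerD; last first.
    by apply: ler_wpM2l; [exact: ltW|exact: time_norm_le].
  by apply: (@le_trans _ _ ((K0 + L * c) * t0)); [rewrite ler_wpM2l // addr_ge0 // mulr_ge0 // ltW|rewrite lerDl !mulr_ge0 // ltW].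
have pk : 0 < (2 ^+ k)^-1 :> R by rewrite invr_gt0 exprn_gt0.
have -> : m x / 2 ^+ k.+1 = (m x / 2 ^+ k) / 2.
  by rewrite exprS invfM mulrA mulrAC.
apply: (@picard_contraction (picard_iter k.+1) (picard_iter k) t0 (fun x => m x / 2 ^+ k)) => //.
- exact: (admissible_iter k.+1).
- exact: admissible_iter.
- by rewrite (_ : EFin \o _ = EFin \o (fun x => (2 ^+ k)^-1 * m x));
    [exact: integrableZE|apply/funext => y /=; rewrite mulrC].
- by move=> y; rewrite mulr_ge0 // ltW.
- by move=> y; rewrite RintegralZr // mulrA ler_wpM2r // ltW.
Qed.

(** The iterates converge geometrically, uniformly on each [[0, t0]], for every
    path and not only for almost every one.  The limit is therefore a path, and
    applying the contraction once more between the limit and the iterates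
    identifies it as a fixed point. *)
Theorem picard_fixpoint : exists2 F : cpath R d -> cpath R d, admissible F &
  forall x t, 0 <= t -> path_at (F x) t = path_at x t + vintegral leb `[0, t] (path_drift F x).
Proof.
pose u x t k := path_at (picard_iter k x) t.
pose F x := path_of (fun t => limn (u x t)).
have cvg_u t0 : 0 <= t0 -> exists m : cpath R d -> R,
   [/\ nu.-integrable setT (EFin \o m), (forall x, 0 <= m x),
      (forall x, \int[nu]_w m w <= 2 * m x) &
      forall k x s, 0 <= s <= t0 -> cvgn (u x s) /\
        `|limn (u x s) - u x s k| <= 2 * m x / 2 ^+ k * expR (lam * s)].
  move=> t0_ge0; have [m [im m0 Em mk]] := picard_majorant t0_ge0.
  exists m; split=> // k x s st.
  have [|cu lu] := @geometric_cvg _ _ (u x s) (m x * expR (lam * s)).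
    by move=> j; rewrite mulrAC; exact: mk.
  by split=> //; have := lu k; rewrite mulrA mulrAC.
have FE x t : 0 <= t -> path_at (F x) t = limn (u x t).
  apply: path_ofE => {}t.
  (* Room to the right of [t] to prove continuity at [t]. *)
  pose t0 := Num.max 0 t + 1.
  have t0_ge0 : 0 <= t0 by rewrite addr_ge0 // le_max lexx.
  have [m [_ m0 _ um]] := cvg_u t0 t0_ge0.
  have um' k s : 0 <= s <= t0 -> `|limn (u x s) - u x s k| <= 2 * m x * expR (lam * t0) / 2 ^+ k.
    move=> st; apply: (le_trans (um k x s st).2).
    rewrite mulrAC ler_wpM2r ?invr_ge0 ?exprn_ge0 // ler_wpM2l ?mulr_ge0 //.
    by rewrite ler_expR ler_wpM2l ?mulr_ge0 // ?(ltW L0) //; case/andP: st.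
  set c := 2 * m x * expR (lam * t0) in um'.
  have c0 : 0 <= c by rewrite !mulr_ge0 // expR_ge0.
  apply/(@cvgrPdist_lt _ _ _ _ (nbhs_filter t)) => e e0.
  have e2 : 0 < e / (3 * (c + 1)) by rewrite divr_gt0 // mulr_gt0 // ltr_wpDl.
  have [k _ /(_ k (leqnn k)) /= ke] := near_infty_natSinv_expn_lt (PosNum e2).
  have cke : c / 2 ^+ k < e / 3.
    move: ke; rewrite ltr_pdivlMr ?mulr_gt0 ?ltr_wpDl // div1r.
    have : 0 < (2 ^+ k)^-1 :> R by rewrite invr_gt0 exprn_gt0.
    by set b := (2 ^+ k)^-1; lra.
  have /(@cvgrPdist_lt _ _ _ _ (nbhs_filter t)) /(_ (e / 3)) :
      (fun s : R => u x (Num.max 0 s) k) @ t --> u x (Num.max 0 t) k.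
    rewrite /u path_at_max0; under eq_fun do rewrite path_at_max0.
    exact: path_at_continuous.
  rewrite divr_gt0 // => /(_ isT).
  have cm : (fun s : R => Num.max 0 s) @ t --> Num.max 0 t.
    by apply: continuous_max; [exact: cvg_cst|exact: cvg_id].
  have := @cvgr_lt _ _ _ _ _ _ cm t0.
  rewrite ltrDl ltr01 => /(_ (nbhs_filter t) isT); apply: filterS2 => s /= st0 us.
  have h1 : `|limn (u x (Num.max 0 t)) - u x (Num.max 0 t) k| < e / 3.
    by apply: le_lt_trans cke; apply: um'; rewrite le_max lexx lerDl /=.
  have h2 : `|u x (Num.max 0 s) k - limn (u x (Num.max 0 s))| < e / 3.
    by rewrite distrC; apply: le_lt_trans cke; apply: um'; rewrite le_max lexx /= ltW.
  apply: (le_lt_trans (ler_distD (u x (Num.max 0 t) k) _ _)).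
  apply: (le_lt_trans (lerD (lexx _) (ler_distD (u x (Num.max 0 s) k) _ _))).
  by lra.
have mF : measurable_fun setT F.
  apply/measurable_cpathP => t t0; under eq_fun do rewrite FE //.
  apply/measurable_mxP => i j.
  apply: (measurable_fun_cvg (h := fun k x => u x t k i j)) => [k|x _].
    have [mk _] := admissible_iter k.
    by have /measurable_mxP := measurable_at t mk; apply.
  have [m [_ _ _ um]] := cvg_u t t0.
  have [|c _] := um 0%N x t; first by rewrite t0 lexx.
  apply: (cvg_comp _ (fun y : 'rV[R]_d => y i j) c); exact: coord_continuous.
have F1 : locally_L1 nu F.
  move=> t0; have [c [c0 xc]] := nu1 t0.
  have [m [im m0 _ um]] := cvg_u `|t0| (normr_ge0 _).
  set e := expR (lam * `|t0|).
  have e0 : 0 <= e by exact: expR_ge0.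
  have mm : measurable_fun setT m by apply/measurable_EFinP; exact: (measurable_int nu).
  have Em0 : 0 <= \int[nu]_x m x by exact: Rintegral_ge0.
  exists (c + (2 * e) * \int[nu]_x m x); split; first by rewrite addr_ge0 // !mulr_ge0.
  move=> t /andP[t_ge0 tt0].
  apply: (@le_trans _ _ (\int[nu]_x (`|path_at x t|%:E + (2 * e)%:E * (m x)%:E))%E).
    apply: ge0_le_integral => //.
    - by apply/measurable_EFinP; apply: measurable_mx_norm; exact: measurable_at.
    - apply: emeasurable_funD; last first.
        by apply: emeasurable_funM => //; exact/measurable_EFinP.
      by apply/measurable_EFinP; apply: measurable_mx_norm; exact: measurable_eval.
    move=> x _; rewrite -EFinM -EFinD lee_fin FE //.
    have [|_] := um 0%N x t; first by rewrite t_ge0 (le_trans tt0) // ler_norm.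
    rewrite expr0 divr1 => h.
    rewrite -[limn _](subrK (path_at x t)) addrC (le_trans (ler_normD _ _)) // lerD2l.
    apply: (le_trans h); rewrite mulrAC ler_wpM2r // ler_wpM2l // ler_expR.
    by rewrite ler_wpM2l ?mulr_ge0 ?(ltW L0) // (le_trans tt0) // ler_norm.
  rewrite ge0_integralD //; last 3 first.
  - by apply/measurable_EFinP; apply: measurable_mx_norm; exact: measurable_eval.
  - by move=> x _; rewrite -EFinM lee_fin !mulr_ge0.
  - by apply: emeasurable_funM => //; exact/measurable_EFinP.
  rewrite ge0_integralZl //; last 3 first.
  - exact/measurable_EFinP.
  - by move=> x _; rewrite lee_fin.
  - by rewrite lee_fin mulr_ge0.
  rewrite EFinD; apply: leeD; first by apply: xc; rewrite t_ge0.
  have <- : (\int[nu]_x m x)%:E = (\int[nu]_x (m x)%:E)%E.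
    by rewrite /Rintegral fineK //; exact: integrable_fin_num im.
  by rewrite -EFinM.
exists F => // x t t0.
have [m [im m0 Em um]] := cvg_u t t0.
suff : path_at (picard F x) t = path_at (F x) t by rewrite picardE.
apply/eqP; rewrite -subr_eq0 -normr_le0; apply/eqP/eqP.
apply: (@le0_geometric _ _ (2 * m x * expR (lam * t))) => k.
apply: (le_trans (ler_distD (path_at (picard_iter k.+1 x) t) _ _)).
have tt : 0 <= t <= t by rewrite t0 lexx.
have pk : 0 < (2 ^+ k)^-1 :> R by rewrite invr_gt0 exprn_gt0.
have h1 : `|path_at (picard F x) t - path_at (picard (picard_iter k) x) t| <=
    (2 * m x / 2 ^+ k) / 2 * expR (lam * t).
  apply: (@picard_contraction F (picard_iter k) t (fun x => 2 * m x / 2 ^+ k)) => //.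
  - exact: admissible_iter.
  - by rewrite (_ : EFin \o _ = EFin \o (fun x => (2 * (2 ^+ k)^-1) * m x));
      [exact: integrableZE|apply/funext => y /=; rewrite mulrAC].
  - by move=> y; rewrite !mulr_ge0 // ltW.
  - move=> y; rewrite (_ : (\int[nu]_w (2 * m w / 2 ^+ k)) = 2 / 2 ^+ k * \int[nu]_w m w).
      by rewrite mulrCA; have := Em y; set b := (2 ^+ k)^-1 in pk *; nra.
    by rewrite -RintegralZl //; apply: eq_Rintegral => w _; rewrite mulrAC.
  - by move=> y s /[dup] st /andP[s0 _]; rewrite FE //; exact: (um k y s st).2.
have h2 := (um k.+1 x t tt).2; rewrite -FE // distrC in h2.
apply: (le_trans (lerD h1 h2)); rewrite exprS invfM.
by set b := (2 ^+ k)^-1; lra.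
Qed.

End picard.

(** * First moment of a centred Gaussian *)

Section gaussian.
Context {R : realType}.
Notation leb := (@lebesgue_measure R).

(** The density of the Gaussian is its Radon-Nikodym derivative. *)
Lemma integral_normal_probE (s : R) (f : R -> \bar R) : measurable_fun setT f ->
  (\int[normal_prob 0 s]_x `|f x| < +oo)%E ->
  (\int[normal_prob 0 s]_x f x = \int[leb]_x (f x * (normal_pdf 0 s x)%:E))%E.
Proof.
move=> mf finf.
rewrite -(Radon_Nikodym_change_of_variables (normal_prob_dominates 0 s))//=; last first.
  by apply/integrableP; split.
have mpdf := measurable_normal_pdf 0 s.
apply: ae_eq_integral => //.
- apply: emeasurable_funM => //; apply: (measurable_int leb).
  by apply: Radon_Nikodym_integrable; exact: normal_prob_dominates.
- by apply: emeasurable_funM => //; exact/measurable_EFinP.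
- apply: ae_eqe_mul2l => /=.
  rewrite Radon_NikodymE//=; first exact: normal_prob_dominates.
  move=> dom; case: cid => /= h [h1 h2 h3].
  apply: integral_ae_eq => //=; first exact/measurable_EFinP.
  by move=> E _ mE; rewrite -h3.
Qed.

(** The elementary bound [|x| <= s * expR (x ^+ 2 / (4 * s ^+ 2))] turns
    [|x|] times the density of variance [s ^+ 2] into a multiple of the
    density of variance [2 * s ^+ 2], whose integral is known. *)
Lemma abs_mul_normal_pdf_le (s x : R) : 0 < s ->
  `|x| * normal_pdf 0 s x <= Num.sqrt 2 * s * normal_pdf 0 (Num.sqrt 2 * s) x.
Proof.
move=> s0; have q0 : 0 < Num.sqrt 2 :> R by rewrite sqrtr_gt0.
rewrite !normal_pdfE ?gt_eqF ?mulr_gt0 //.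
have -> : normal_peak (Num.sqrt 2 * s) = (Num.sqrt 2)^-1 * normal_peak s.
  rewrite /normal_peak exprMn sqr_sqrtr // -mulrnAr -mulrA sqrtrM // invfM.
  by rewrite -mulrnAr.
rewrite /normal_fun !subr0 exprMn sqr_sqrtr //.
have pk := normal_peak_ge0 s.
set p := normal_peak s in pk *.
have -> : Num.sqrt 2 * s * ((Num.sqrt 2)^-1 * p * expR (- x ^+ 2 / (2 * s ^+ 2 *+ 2))) =
   p * (s * expR (- x ^+ 2 / (2 * s ^+ 2 *+ 2))).
  by field; rewrite gt_eqF.
rewrite mulrCA ler_wpM2l //.
pose u := `|x| / s.
have xu : `|x| = u * s by rewrite /u mulfVK // gt_eqF.
have -> : - x ^+ 2 / (s ^+ 2 *+ 2) = - (u ^+ 2 / 4) + - x ^+ 2 / (2 * s ^+ 2 *+ 2).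
  rewrite -(real_normK (num_real x)) xu; field; rewrite gt_eqF //.
rewrite expRD mulrA; apply: ler_wpM2r; first exact: expR_ge0.
rewrite xu mulrAC -[leRHS]mul1r.
apply: ler_wpM2r; first exact: ltW.
rewrite expRN ler_pdivrMr ?expR_gt0 // mul1r.
apply: le_trans (expR_ge1Dx _).
by have := sqr_ge0 (1 - u / 2); nra.
Qed.

(** The integral is computed with the density only for the truncations
    [min |x| n], known beforehand to have finite mean, and monotone
    convergence concludes. *)
Lemma integral_abs_normal_le (s : R) : 0 < s ->
  (\int[normal_prob 0 s]_x `|x|%:E <= (Num.sqrt 2 * s)%:E)%E.
Proof.
move=> s0; pose f n (x : R) := (Num.min `|x| n%:R)%:E.
have mf n : measurable_fun setT (f n).
  by apply/measurable_EFinP; apply: measurable_minr => //; exact: normr_measurable.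
have f0 n x : (0 <= f n x)%E by rewrite lee_fin le_min normr_ge0 ler0n.
have cf x : f n x @[n --> \oo] --> `|x|%:E.
  apply: cvg_near_cst; exists (Num.truncn `|x|).+1 => // n /= xn.
  by rewrite /f min_l // (le_trans (ltW (truncnS_gt _))) // ler_nat.
have := @cvg_monotone_convergence _ _ _ (normal_prob 0 s) setT measurableT f mf
  (fun n x _ => f0 n x).
have ndf x : setT x -> nondecreasing_seq (f ^~ x).
  by move=> _ n m nm; rewrite lee_fin le_min ge_min lexx /= ge_min ler_nat nm orbT.
move=> /(_ ndf) cI.
rewrite (_ : \int[_]_x _ = \int[normal_prob 0 s]_x limn (f^~ x))%E; last first.
  by apply: eq_integral => x _; apply/esym/cvg_lim => //; exact: cf.
apply: (cvge_to_le cI); apply: nearW => n.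
have q0 : 0 < Num.sqrt 2 :> R by rewrite sqrtr_gt0.
rewrite integral_normal_probE //; last first.
  under eq_integral do rewrite gee0_abs //.
  rewrite (@le_lt_trans _ _ (\int[normal_prob 0 s]_x (n%:R%:E)))%E //.
    apply: ge0_le_integral => //; first exact: mf.
    by move=> x _; rewrite /f lee_fin ge_min lexx orbT.
  by rewrite (integral_cstT (normal_prob 0 s)) ltry.
apply: (@le_trans _ _ (\int[leb]_x ((Num.sqrt 2 * s)%:E * (normal_pdf 0 (Num.sqrt 2 * s) x)%:E))%E).
  apply: ge0_le_integral => //.
  - by move=> x _; rewrite mule_ge0 // lee_fin normal_pdf_ge0.
  - apply: emeasurable_funM; first exact: mf.
    by apply/measurable_EFinP; exact: measurable_normal_pdf.
  - by apply: emeasurable_funM => //; apply/measurable_EFinP; exact: measurable_normal_pdf.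
  move=> x _; rewrite -!EFinM lee_fin (le_trans _ (abs_mul_normal_pdf_le x s0)) //.
  by rewrite ler_wpM2r ?normal_pdf_ge0 // ge_min lexx.
rewrite ge0_integralZl //; last 3 first.
- by apply/measurable_EFinP; exact: measurable_normal_pdf.
- by move=> x _; rewrite lee_fin normal_pdf_ge0.
- by rewrite lee_fin mulr_ge0 // ltW.
by rewrite integral_normal_pdf mule1.
Qed.

End gaussian.

(** * Laws on path space *)

(** Dynkin's pi-lambda theorem for finite measures. *)
Lemma measure_eq_generated dT (T : measurableType dT) (R : realType)
    (G : set (set T)) (mu nu : {measure set T -> \bar R}) :
  G `<=` measurable -> setI_closed G -> (mu setT < +oo)%E -> mu setT = nu setT ->
  (forall X, G X -> mu X = nu X) -> forall X, <<s G >> X -> mu X = nu X.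
Proof.
move=> mG GI muT munuT munuG X GX.
have eG : [set Y | G Y /\ Y `<=` setT] = G.
  by apply/seteqP; split => Y; [case|split].
apply: (g_sigma_algebra_measure_unique_trace G setT measurableT); rewrite ?eG //.
Qed.

Section dyadic_grid.
Context (R : realType) (d : nat).
Notation C := (cpath R d).

Definition increment (m j : nat) (w : C) : 'rV[R]_d :=
  path_at w (dyadic R m j.+1) - path_at w (dyadic R m j).

Lemma measurable_increment m j : measurable_fun setT (increment m j).
Proof. by apply: measurable_mxB; exact: measurable_eval. Qed.

Definition increment_box m (A : nat -> 'I_d -> set R) : set C :=
  [set w | forall j k, A j k (increment m j w 0 k)].

Lemma measurable_increment_box m A : (forall j k, measurable (A j k)) ->
  measurable (increment_box m A).
Proof.
move=> mA; apply: measurable_forall => j; apply: measurable_forall => k.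
rewrite -[X in measurable X]setTI.
by have /measurable_mxP/(_ 0 k) := measurable_increment m j; apply.
Qed.

(** Conditions on the starting point and on finitely many increments over the
    grid of mesh [2 ^ -m]; indices from [N] on are left free. *)
Definition grid_boxes m : set (set C) :=
  [set E | exists N (A0 : set 'rV[R]_d) A, [/\ measurable A0,
     (forall j k, measurable (A j k)), (forall j k, (N <= j)%N -> A j k = setT) &
     E = [set w | A0 (path_at w 0)] `&` increment_box m A]].

Lemma grid_boxes_measurable m : grid_boxes m `<=` measurable.
Proof.
move=> _ [N [A0 [A [mA0 mA _ ->]]]]; apply: measurableI.
  by rewrite -[X in measurable X]setTI; apply: measurable_eval.
exact: measurable_increment_box.
Qed.

Lemma grid_boxesI m : setI_closed (grid_boxes m).
Proof.
move=> _ _ [N [A0 [A [mA0 mA NA ->]]]] [N' [A0' [A' [mA0' mA' NA' ->]]]].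
exists (maxn N N'), (A0 `&` A0'), (fun j k => A j k `&` A' j k); split.
- exact: measurableI.
- by move=> j k; exact: measurableI.
- by move=> j k; rewrite geq_max => /andP[/NA -> /NA' ->]; rewrite setTI.
apply/seteqP; split => w.
  by move=> [[/= a0 a] [a0' a']].
move=> [/= [a0 a0'] a]; split; split => // j k; first exact: (a j k).1.
exact: (a j k).2.
Qed.

Definition grid_evals m : set (set C) :=
  [set E | exists j (U : set 'rV[R]_d), measurable U /\
     E = [set w | U (path_at w (dyadic R m j))]].

(** The value at a grid point is the starting point plus the increments before
    it. *)
Lemma grid_evals_boxes m : <<s grid_evals m >> `<=` <<s grid_boxes m >>.
Proof.
pose T := g_sigma_algebraType (grid_boxes m).
have me j : measurable_fun setT (fun w : T => path_at w (dyadic R m j)).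
  elim: j => [|j IH].
    rewrite /dyadic mul0r => _ U mU; rewrite setTI; apply: sub_sigma_algebra.
    exists 0%N, U, (fun _ _ => setT); split => //.
    by rewrite (_ : increment_box _ _ = setT) ?setIT //; apply/seteqP; split.
  rewrite (_ : (fun _ => _) = fun w : T => path_at w (dyadic R m j) + increment m j w); last first.
    by apply/funext => w; rewrite /increment addrC subrK.
  apply: measurable_mxD => //; apply/measurable_mxP => i k; rewrite (ord1 i).
  move=> _ U mU; rewrite setTI; apply: sub_sigma_algebra.
  pose A j' k' := if (j' == j) && (k' == k) then U else setT.
  exists j.+1, setT, A; split => //.
  - by move=> j' k'; rewrite /A; case: ifP.
  - by move=> j' k' jj'; rewrite /A; case: eqP jj' => [->|//]; rewrite ltnn.
  apply/seteqP; split => [w Uw|w [_ /(_ j k)]]; last by rewrite /A !eqxx.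
  split => // j' k'; rewrite /A; case: eqP => [->|//]; case: eqP => [->|//].
  exact: Uw.
apply: smallest_sub; first exact: smallest_sigma_algebra.
by move=> _ [j [U [mU ->]]]; have := me j measurableT U mU; rewrite setTI.
Qed.

Lemma grid_evals_nested m n : (m <= n)%N -> <<s grid_evals m >> `<=` <<s grid_evals n >>.
Proof.
move=> /subnKC <-; apply: sub_sigma_algebra2 => _ [j [U [mU ->]]].
exists (j * 2 ^ (n - m))%N, U; split => //.
suff -> : dyadic R (m + (n - m)) (j * 2 ^ (n - m)) = dyadic R m j by [].
rewrite /dyadic natrM natrX exprD; field.
by rewrite !expf_neq0.
Qed.

(** The boxes of the network only involve dyadic times. *)
Lemma borel_path_grid :
  @measurable _ C `<=` <<s \bigcup_m <<s grid_evals m >> >>.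
Proof.
apply: (sigma_algebra_network (E := @path_box R d)).
- exact: smallest_sigma_algebra.
- move=> [[[N m] l] q].
  pose T := g_sigma_algebraType (\bigcup_m <<s grid_evals m >>).
  suff : measurable (path_box (N, m, l, q) : set T) by [].
  apply: measurable_forall => p; apply: measurable_forall => j.
  have [jN|jN] := boolP (dyadic R p j <= N%:R); last first.
    by rewrite [X in measurable X](_ : _ = setT) //; apply/seteqP; split.
  set v := map_mx ratr (nth 0 q (Num.truncn (2 ^+ m * dyadic R p j))).
  rewrite [X in measurable X](_ : _ = [set w : T | `|path_at w (dyadic R p j) - v| <= l.+1%:R^-1]).
    apply: sub_sigma_algebra; exists p => //; apply: sub_sigma_algebra.
    exists j, [set x | `|x - v| <= l.+1%:R^-1]; split => //.
    rewrite -[X in measurable X]setTI; apply: measurable_fun_le => //.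
    by apply: measurable_mx_norm; apply: measurable_mxB.
  by apply/seteqP; split => x //= /(_ isT).
- exact: path_box_network.
Qed.

(** The pi-lambda theorem is used twice: on a fixed grid, where the boxes are
    stable under intersection, and then on the union over the grids, which is
    stable because the grids are nested. *)
Lemma cpath_law_unique (mu nu : {measure set C -> \bar R}) :
  (mu setT < +oo)%E -> mu setT = nu setT ->
  (forall m E, grid_boxes m E -> mu E = nu E) ->
  forall S, measurable S -> mu S = nu S.
Proof.
move=> muT munuT munu S /borel_path_grid.
apply: measure_eq_generated => //.
- move=> X [m _ /grid_evals_boxes]; apply: smallest_sub.
    exact: sigma_algebra_measurable.
  exact: grid_boxes_measurable.
- move=> X Y [m _ mX] [n _ nY]; exists (maxn m n) => //.
  apply: (@measurableI _ (g_sigma_algebraType (grid_evals (maxn m n)))).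
    by apply: grid_evals_nested mX; rewrite leq_maxl.
  by apply: grid_evals_nested nY; rewrite leq_maxr.
- move=> X [m _ /grid_evals_boxes]; apply: measure_eq_generated => //.
  + exact: grid_boxes_measurable.
  + exact: grid_boxesI.
  + exact: munu.
Qed.

End dyadic_grid.

(** * The driving path of an additive equation *)

Lemma ae_eq_measure dT (T : measurableType dT) (R : realType)
    (mu : {measure set T -> \bar R}) (A B : set T) :
  measurable A -> measurable B -> (\forall w \ae mu, A w <-> B w) -> mu A = mu B.
Proof.
have le (A' B' : set T) : measurable A' -> measurable B' ->
    (\forall w \ae mu, A' w -> B' w) -> (mu A' <= mu B')%E.
  move=> mA mB [N [mN N0 AN]].
  rewrite (@le_trans _ _ (mu (B' `|` N))) //.
    apply: le_measure; rewrite ?inE //; first exact: measurableU.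
    move=> w A'w; have [Nw|nNw] := pselect (N w); first by right.
    by left; apply: contrapT => B'w; apply/nNw/AN => /(_ A'w).
  by rewrite (le_trans (measureU2 _ _ _)) // [X in (_ + X)%E](_ : _ = 0%E) ?adde0.
move=> mA mB AB; apply/eqP; rewrite eq_le !le //.
  by apply: filterS AB => w [].
by apply: filterS AB => w [].
Qed.

Section noise.
Context (R : realType) (d : nat).
Notation C := (cpath R d).

(** The process that an equation with additive noise perturbs by its drift. *)
Definition noise_path (x : 'rV[R]_d) (b : C) : C :=
  path_of (fun t => x + Num.sqrt 2 *: path_at b t).

Lemma noise_pathE x b t : 0 <= t ->
  path_at (noise_path x b) t = x + Num.sqrt 2 *: path_at b t.
Proof.
apply: path_ofE => s; under eq_fun do rewrite path_at_max0.
by apply: cvgD; [exact: cvg_cst|apply: cvgZr; exact: path_at_continuous].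
Qed.

Lemma measurable_noise_path dT (T : measurableType dT) (f : T -> 'rV[R]_d) (g : T -> C) :
  measurable_fun setT f -> measurable_fun setT g ->
  measurable_fun setT (fun w => noise_path (f w) (g w)).
Proof.
move=> mf mg; apply/measurable_cpathP => t t0.
under eq_fun do rewrite noise_pathE //.
by apply: measurable_mxD => //; apply: measurable_mxZ; exact: measurable_at.
Qed.

Section one_motion.
Context dW (W : measurableType dW) (P : probability W R).
Variables (x0 : W -> 'rV[R]_d) (B : W -> C).
Hypotheses (mx0 : measurable_fun setT x0) (mB : measurable_fun setT B).
Hypotheses (bB : brownian P B) (xB : indep_pair P x0 B).

(** The probability that the first [N] increments of a Brownian motion over the
    grid lie in the box. *)
Definition gauss_box m N (A : nat -> 'I_d -> set R) : \bar R :=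
  (\prod_(j < N) \prod_(k < d)
    normal_prob 0 (Num.sqrt (dyadic R m j.+1 - dyadic R m j)) (A j k))%E.

Lemma dyadic_lt m j : dyadic R m j < dyadic R m j.+1.
Proof. by rewrite /dyadic ltr_pM2r ?invr_gt0 ?exprn_gt0 // ltr_nat. Qed.

(** Increments over disjoint intervals are independent, and so are the
    coordinates of each of them. *)
Lemma brownian_increment_box m N A : (forall j k, measurable (A j k)) ->
  (forall j k, (N <= j)%N -> A j k = setT) ->
  P (B @^-1` increment_box m A) = gauss_box m N A.
Proof.
move=> mA NA; have [_ gB iB] := bB.
pose D (j : 'I_N) : set 'rV[R]_d := [set v | forall k, A j k (v 0 k)].
have mD j : measurable (D j).
  apply: measurable_forall => k; rewrite -[X in measurable X]setTI.
  exact: (measurable_mx_coord 0 k).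
rewrite (_ : B @^-1` _ = [set w | forall j : 'I_N, D j (increment m j (B w))]).
  rewrite (iB N (dyadic R m) (dyadic_ge0 _ _ _) _ D) //; last by move=> j; exact/ltW/dyadic_lt.
  apply: eq_bigr => j _.
  by rewrite -(gB _ _ (dyadic_ge0 _ _ _) (dyadic_lt m j)).
apply/seteqP; split => w /= h j; first by move=> k; exact: h.
move=> k; have [jN|Nj] := ltnP j N; last by rewrite NA.
exact: (h (Ordinal jN) k).
Qed.

(** The right-hand side depends only on the law of the starting point, not on
    the probability space. *)
Lemma noise_grid_box m N A0 A : measurable A0 ->
  (forall j k, measurable (A j k)) -> (forall j k, (N <= j)%N -> A j k = setT) ->
  P ((fun w => noise_path (x0 w) (B w)) @^-1`
      ([set w | A0 (path_at w 0)] `&` increment_box m A)) =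
  (P (x0 @^-1` A0) * gauss_box m N (fun j k => (fun r : R => (Num.sqrt 2 * r)%R) @^-1` A j k))%E.
Proof.
move=> mA0 mA NA.
pose A' j k : set R := (fun r => Num.sqrt 2 * r) @^-1` A j k.
have mA' j k : measurable (A' j k).
  rewrite -[X in measurable X]setTI.
  have : measurable_fun setT (fun r : R => Num.sqrt 2 * r) by exact: measurable_funM.
  by apply.
rewrite -brownian_increment_box //; last by move=> j k /NA ->.
rewrite -xB //; last exact: measurable_increment_box.
apply: ae_eq_measure.
- rewrite -[X in measurable X]setTI.
  apply: (measurable_noise_path mx0 mB) => //; apply: grid_boxes_measurable.
  by exists N, A0, A.
- apply: measurableI.
    by rewrite -[X in measurable X]setTI; exact: mx0.
  by rewrite -[X in measurable X]setTI; apply: mB => //; exact: measurable_increment_box.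
have [B0 _ _] := bB; apply: filterS B0 => w B0.
have e0 : path_at (noise_path (x0 w) (B w)) 0 = x0 w.
  by rewrite noise_pathE // B0 scaler0 addr0.
have ei j k : increment m j (noise_path (x0 w) (B w)) 0 k =
    Num.sqrt 2 * increment m j (B w) 0 k.
  rewrite /increment !noise_pathE ?dyadic_ge0 // !mxE; ring.
split=> -[/= h0 h]; split.
- by move: h0; rewrite e0.
- by move=> j k; rewrite /= -ei; exact: h.
- by move: h0; rewrite -{1}e0.
- by move=> j k; rewrite ei; exact: h.
Qed.

(** The norm is at most the sum of the absolute values of the [d] coordinates,
    each of which is a centred Gaussian of variance [t]. *)
Lemma brownian_norm_le t : 0 < t ->
  (\int[P]_w `|path_at (B w) t|%:E <= (d%:R * (Num.sqrt 2 * Num.sqrt t))%:E)%E.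
Proof.
move=> t0; have [B0 gB _] := bB.
pose D k w := (path_at (B w) t - path_at (B w) 0) 0 k.
have mD k : measurable_fun setT (D k).
  by have /measurable_mxP := measurable_mxB (measurable_at t mB) (measurable_at 0 mB); apply.
have law_D k S : measurable S -> P (D k @^-1` S) = normal_prob 0 (Num.sqrt t) S.
  move=> mS; pose A k' := if k' == k then S else setT.
  have mA k' : measurable (A k') by rewrite /A; case: ifP.
  have := gB 0 t (lexx _) t0 A mA; rewrite subr0 (bigD1 k) //= big1 ?mule1.
    rewrite {2}/A eqxx => <-; congr (P _); apply/seteqP; split => w /=.
      by move=> Sw k'; rewrite /A; case: eqP => [->|].
    by move=> /(_ k); rewrite /A eqxx.
  by move=> k' /negbTE k'k; rewrite /A k'k; exact: probability_setT.
have ED k : (\int[P]_w `|D k w|%:E <= (Num.sqrt 2 * Num.sqrt t)%:E)%E.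
  have t1 : 0 < Num.sqrt t by rewrite sqrtr_gt0.
  apply: le_trans (integral_abs_normal_le t1).
  have mDk : @measurable_fun _ _ W (measurableTypeR R) setT (D k) by exact: mD.
  pose X := @mfun_Sub _ _ W (measurableTypeR R) (D k) (mem_set mDk).
  have -> : (\int[normal_prob 0 (Num.sqrt t)]_x `|x|%:E = \int[distribution P X]_x `|x|%:E)%E.
    by apply: eq_measure_integral => S mS _; exact: (esym (law_D k S mS)).
  by rewrite ge0_integral_distribution //; apply/measurable_EFinP; exact: normr_measurable.
apply: (@le_trans _ _ (\int[P]_w (\sum_(k < d) `|D k w|%:E))%E).
  apply: ae_ge0_le_integral => //.
  - by apply/measurable_EFinP; apply: measurable_mx_norm; exact: measurable_at.
  - by move=> w _; apply: sume_ge0.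
  - by apply: emeasurable_sum => k; apply/measurable_EFinP; exact: measurableT_comp.
  apply: filterS B0 => w B0 _; rewrite sumEFin lee_fin.
  apply: normr_mx_le; first exact: sumr_ge0.
  move=> i k; rewrite (ord1 i) (bigD1 k) //= /D B0 subr0 lerDl.
  exact: sumr_ge0.
rewrite ge0_integral_sum //; last first.
  by move=> k; apply/measurable_EFinP; exact: measurableT_comp.
apply: (le_trans (lee_sum _ (fun k _ => ED k))).
by rewrite sumEFin lee_fin sumr_const card_ord mulr_natl.
Qed.

Lemma locally_L1_noise :
  P.-integrable setT (EFin \o (fun w => `|x0 w|)) ->
  locally_L1 P (fun w => noise_path (x0 w) (B w)).
Proof.
move=> ix0 t0.
pose c : R := \int[P]_w `|x0 w|.
have c0 : 0 <= c by exact: Rintegral_ge0.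
exists (c + Num.sqrt 2 * (d%:R * (Num.sqrt 2 * Num.sqrt t0))); split.
  by rewrite addr_ge0 // !mulr_ge0.
move=> t /andP[t_ge0 tt0].
have EB : (\int[P]_w `|path_at (B w) t|%:E <= (d%:R * (Num.sqrt 2 * Num.sqrt t0))%:E)%E.
  move: t_ge0; rewrite le_eqVlt => /predU1P[<-|t_gt0]; last first.
    apply: (le_trans (brownian_norm_le t_gt0)).
    by rewrite lee_fin !ler_wpM2l // ler_wsqrtr.
  have -> : (\int[P]_w `|path_at (B w) 0|%:E = \int[P]_w (cst 0 w))%E.
    apply: ae_eq_integral => //.
      by apply/measurable_EFinP; apply: measurable_mx_norm; exact: measurable_at.
    by have [B0 _ _] := bB; apply: filterS B0 => w -> _; rewrite normr0.
  by rewrite integral0 lee_fin !mulr_ge0.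
have mnx : measurable_fun setT (fun w => `|x0 w|) by exact: measurable_mx_norm.
have mnB : measurable_fun setT (fun w => `|path_at (B w) t|).
  by apply: measurable_mx_norm; exact: measurable_at.
apply: (@le_trans _ _ (\int[P]_w (`|x0 w|%:E + (Num.sqrt 2)%:E * `|path_at (B w) t|%:E))%E).
  apply: ge0_le_integral => //.
  - by apply/measurable_EFinP; apply: measurable_mx_norm; apply: measurable_at; exact: measurable_noise_path.
  - by apply: emeasurable_funD; [|apply: emeasurable_funM => //]; exact/measurable_EFinP.
  move=> w _; rewrite -EFinM -EFinD lee_fin noise_pathE // (le_trans (ler_normD _ _)) //.
  by rewrite normrZ lerD2l ger0_norm.
rewrite ge0_integralD //; last 2 first.
- exact/measurable_EFinP.
- by apply: emeasurable_funM => //; exact/measurable_EFinP.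
rewrite ge0_integralZl //; last exact/measurable_EFinP.
rewrite EFinD; apply: leeD; last by rewrite EFinM; apply: lee_wpmul2l => //; rewrite lee_fin.
by rewrite /c /Rintegral fineK //; exact: integrable_fin_num ix0.
Qed.

End one_motion.

End noise.

(** * Independent families *)

Section tuple_box.
Context dT (T : measurableType dT) (R : realType) (n : nat).

Definition tuple_box (A : 'I_n -> set T) : set (n.-tuple T) :=
  [set x | forall i, A i (tnth x i)].

Lemma measurable_tuple_box A : (forall i, measurable (A i)) -> measurable (tuple_box A).
Proof.
move=> mA; apply: measurable_forall => i.
by rewrite -[X in measurable X]setTI; exact: measurable_tnth.
Qed.

Lemma tuple_law_unique (mu nu : {measure set (n.-tuple T) -> \bar R}) :
  (mu setT < +oo)%E ->
  (forall A, (forall i, measurable (A i)) -> mu (tuple_box A) = nu (tuple_box A)) ->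
  forall S, measurable S -> mu S = nu S.
Proof.
move=> muT munu S mS.
have munuT : mu setT = nu setT.
  have := munu (fun=> setT) (fun=> measurableT).
  by rewrite (_ : tuple_box _ = setT) //; apply/seteqP; split.
pose G : set (set (n.-tuple T)) :=
  [set E | exists2 A, (forall i, measurable (A i)) & E = tuple_box A].
have : <<s G >> S.
  move: mS; apply: smallest_sub; first exact: smallest_sigma_algebra.
  move=> E; rewrite -bigcup_seq => -[i _ [U mU <-]].
  apply: sub_sigma_algebra; exists (fun j => if j == i then U else setT).
    by move=> j; case: ifP.
  rewrite setTI; apply/seteqP; split => x /=.
    by move=> Ux j; case: eqP => [->|].
  by move=> /(_ i); rewrite eqxx.
apply: measure_eq_generated => //.
- by move=> _ [A mA ->]; exact: measurable_tuple_box.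
- move=> _ _ [A mA ->] [A' mA' ->]; exists (fun i => A i `&` A' i).
    by move=> i; exact: measurableI.
  apply/seteqP; split => x; first by move=> [xA xA'] i; split; [exact: xA|exact: xA'].
  by move=> h; split => i; have [] := h i.
- by move=> _ [A mA ->]; exact: munu.
Qed.

End tuple_box.

Section independence.
Context dW (W : measurableType dW) (R : realType) (P : probability W R).
Context dT (T : measurableType dT).

(** The pi-lambda theorem, one coordinate at a time: after [k] steps the
    product rule holds when the sets of index at least [k] are taken in the
    generating class. *)
Lemma indep_family_generated n (G : set (set T)) (X : 'I_n -> W -> T) :
  (forall i, measurable_fun setT (X i)) ->
  G `<=` measurable -> setI_closed G -> G setT -> measurable `<=` <<s G >> ->
  (forall A, (forall i, G (A i)) ->
    P [set w | forall i, A i (X i w)] = (\prod_(i < n) P (X i @^-1` A i))%E) ->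
  indep_family P X.
Proof.
move=> mX mG GI GT sG indG.
have mXA i A : measurable A -> measurable (X i @^-1` A).
  by move=> mA; rewrite -[X in measurable X]setTI; exact: mX.
(* Coordinates below [k] are arbitrary, the others lie in [G]. *)
suff ind k : forall A, (forall i, measurable (A i)) -> (forall i : 'I_n, (k <= i)%N -> G (A i)) ->
    P [set w | forall i, A i (X i w)] = (\prod_(i < n) P (X i @^-1` A i))%E.
  by move=> A mA; apply: (ind n) => // i; rewrite leqNgt ltn_ord.
elim: k => [|k IH] A mA GA; first by apply: indG => i; exact: GA.
have [kn|nk] := ltnP k n; last first.
  by apply: IH => // i ki; move: (ltn_ord i); rewrite ltnNge (leq_trans nk).
pose i0 := Ordinal kn.
pose upd S i := if i == i0 then S else A i.
have updE S : [set w | forall i, upd S i (X i w)] =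
    X i0 @^-1` S `&` [set w | forall i, upd setT i (X i w)].
  apply/seteqP; split => w /=.
    move=> h; split; first by have := h i0; rewrite /upd eqxx.
    by move=> i; have := h i; rewrite /upd; case: eqP.
  by move=> [Sw h] i; have := h i; rewrite /upd; case: eqP => [->|].
have prodE S : (\prod_(i < n) P (X i @^-1` upd S i) =
    P (X i0 @^-1` S) * \prod_(i < n | i != i0) P (X i @^-1` A i))%E.
  rewrite (bigD1 i0) //= {1}/upd eqxx; congr (_ * _)%E.
  by apply: eq_bigr => i /negbTE ii0; rewrite /upd ii0.
have updA : upd (A i0) = A.
  by apply/funext => i; rewrite /upd; case: eqP => [->|].
have mE : measurable [set w | forall i, upd setT i (X i w)].
  apply: measurable_forall => i; apply: mXA; rewrite /upd; case: ifP => // _; exact: mA.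
set E := [set w | _] in mE updE.
pose c := (\prod_(i < n | i != i0) P (X i @^-1` A i))%E.
have c0 : (0 <= c)%E by apply: prode_ge0.
have cfin : c \is a fin_num.
  rewrite /c; elim/big_ind : _ => // [x y|i _]; first exact: fin_numM.
  by apply: fin_num_measure; exact: mXA.
have cE : c = (fine c)%:E by rewrite fineK.
have fc0 : 0 <= fine c by rewrite fine_ge0.
pose X0 : {mfun W >-> T} := mfun_Sub (mem_set (mX i0)).
(* As functions of the set at index [k], both sides of the product rule are
   finite measures. *)
pose m1 := pushforward (mrestr P mE) X0.
pose m2 := mscale (NngNum fc0) (distribution P X0).
rewrite -updA updE prodE -/c cE muleC.
suff h : forall S, measurable S -> m1 S = m2 S by exact: h.
have hG S : G S -> m1 S = m2 S.
  move=> GS.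
  have -> : m1 S = P [set w | forall i, upd S i (X i w)] by rewrite updE.
  have -> : m2 S = (\prod_(i < n) P (X i @^-1` upd S i))%E.
    by rewrite prodE /m2 /mscale /= -cE muleC.
  apply: IH => i; rewrite /upd; case: eqP => [_|]; [exact: mG|by move=> _; exact: mA|by []|].
  move=> ii0 ki; apply: GA; rewrite ltn_neqAle ki andbT.
  by apply/eqP => kii; apply: ii0; apply/val_inj.
move=> S /sG; apply: measure_eq_generated => //; last exact: hG.
- rewrite /m1 /mrestr; apply: (le_lt_trans (probability_le1 P _)); last by rewrite ltry.
  by apply: measurableI => //; exact: mXA.
Qed.

End independence.

Section independent_pairs.
Context dW (W : measurableType dW) (R : realType) (P : probability W R).
Context dS dT (S : measurableType dS) (T : measurableType dT) (n : nat).
Variables (X : 'I_n -> W -> S) (Y : 'I_n -> W -> T).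
Hypotheses (mX : forall i, measurable_fun setT (X i)) (mY : forall i, measurable_fun setT (Y i)).
Hypotheses (indX : indep_family P X) (indY : indep_family P Y).
Hypothesis indXY : indep_pair P (fun w => [tuple X i w | i < n]) (fun w => [tuple Y i w | i < n]).

Lemma indep_pairs_box (A : 'I_n -> set S) (C : 'I_n -> set T) :
  (forall i, measurable (A i)) -> (forall i, measurable (C i)) ->
  P [set w | forall i, (A i `*` C i) (X i w, Y i w)] =
  (\prod_(i < n) (P (X i @^-1` A i) * P (Y i @^-1` C i)))%E.
Proof.
move=> mA mC; rewrite big_split /= -indX // -indY //.
have := indXY (measurable_tuple_box mA) (measurable_tuple_box mC).
have -> : (fun w => [tuple X i w | i < n]) @^-1` tuple_box A = [set w | forall i, A i (X i w)].
  by apply/seteqP; split => w /= h i; have := h i; rewrite tnth_mktuple.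
have -> : (fun w => [tuple Y i w | i < n]) @^-1` tuple_box C = [set w | forall i, C i (Y i w)].
  by apply/seteqP; split => w /= h i; have := h i; rewrite tnth_mktuple.
move=> <-; congr (P _); apply/seteqP; split => w /=.
  by move=> h; split => i; have [] := h i.
by move=> [hA hC] i; split; [exact: hA|exact: hC].
Qed.

Lemma indep_pair_component i0 : indep_pair P (X i0) (Y i0).
Proof.
move=> A C mA mC.
pose A' i := if i == i0 then A else setT.
pose C' i := if i == i0 then C else setT.
have := @indep_pairs_box A' C' _ _.
rewrite (bigD1 i0) //= {2 3}/A' {2 3}/C' !eqxx big1 ?mule1; last first.
  move=> i /negbTE ii0; rewrite /A' /C' ii0 !preimage_setT.
  by rewrite [X in (X * X)%E](_ : _ = 1%E) ?mule1 //; exact: probability_setT.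
move=> <-; last 2 first.
- by move=> i; rewrite /A'; case: ifP.
- by move=> i; rewrite /C'; case: ifP.
congr (P _); apply/seteqP; split => w /=.
  by move=> [Aw Cw] i; rewrite /A' /C'; case: eqP => [->|].
by move=> /(_ i0); rewrite /A' /C' !eqxx.
Qed.

(** Independence within the two families and between them is what makes the
    product rule hold on rectangles. *)
Lemma indep_family_pairs : indep_family P (fun i w => (X i w, Y i w)).
Proof.
pose G : set (set (S * T)) := [set A `*` C | A in measurable & C in measurable].
apply: (@indep_family_generated _ _ _ _ _ _ _ G).
- by move=> i; exact: measurable_fun_pair.
- by move=> _ [A mA] [C mC] <-; exact: measurableX.
- move=> _ _ [A mA] [C mC] <- [A' mA'] [C' mC'] <-; rewrite -setXI.
  by exists (A `&` A'); [exact: measurableI|exists (C `&` C') => //; exact: measurableI].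
- by exists setT => //; exists setT => //; rewrite setXTT.
- by rewrite measurable_prod_measurableType.
move=> E GE.
have /choice[A hA] : forall i, exists A,
    measurable A /\ exists2 C, measurable C & A `*` C = E i.
  by move=> i; have [A mA [C mC AC]] := GE i; exists A; split => //; exists C.
have /choice[C hC] : forall i, exists C, measurable C /\ A i `*` C = E i.
  by move=> i; have [_ [C mC AC]] := hA i; exists C.
have mA i : measurable (A i) by have [] := hA i.
have mC i : measurable (C i) by have [] := hC i.
have -> : E = fun i => A i `*` C i by apply/funext => i; have [] := hC i.
rewrite indep_pairs_box //; apply: eq_bigr => i _.
by rewrite -(indep_pair_component i).
Qed.

End independent_pairs.

(** * Uniqueness for interacting systems *)

(** Gronwall's lemma in the form used below: an a priori bound that can be
    halved up to a constant [c] improves to [2 * c]. *)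
Lemma halving (R : realType) (I : Type) (D : set I) (v : I -> R) (c : R) :
  (exists N, forall i, D i -> v i <= N) ->
  (forall N, 0 <= N -> (forall i, D i -> v i <= N) -> forall i, D i -> v i <= c + N / 2) ->
  0 <= c -> forall i, D i -> v i <= 2 * c.
Proof.
move=> [N0 vN0] half c0 i Di.
pose N := Num.max N0 0.
have vk k : forall j, D j -> v j <= 2 * c + N / 2 ^+ k.
  elim: k => [|k IH] j Dj.
    rewrite expr0 divr1 (le_trans (vN0 j Dj)) // (le_trans (_ : N0 <= N)) ?le_max ?lexx //.
    by rewrite lerDr mulr_ge0.
  have Nk : 0 <= 2 * c + N / 2 ^+ k.
    by rewrite addr_ge0 ?mulr_ge0 ?invr_ge0 ?exprn_ge0 // le_max lexx orbT.
  apply: (le_trans (half _ Nk IH j Dj)).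
  by rewrite exprS invfM; set b := (2 ^+ k)^-1; lra.
rewrite -subr_le0; apply: (@le0_geometric _ _ N) => k.
by rewrite lerBlDl; exact: vk.
Qed.

Lemma path_bounded (R : realType) (d : nat) (x : cpath R d) (t0 : R) :
  exists2 b, 0 <= b & forall t, 0 <= t <= t0 -> `|path_at x t| <= b.
Proof.
have : compact (path_at x @` `[0, t0]%classic).
  apply: continuous_compact; last exact: segment_compact.
  by apply: continuous_subspaceT; exact: path_at_continuous.
move=> /compact_bounded[M [_ MA]].
exists (`|M| + 1); first by rewrite addr_ge0.
move=> t t0t; apply: MA; first by rewrite ltr_pwDr // ler_norm.
by exists t.
Qed.

Lemma ae_prob_ex dW (W : measurableType dW) (R : realType) (P : probability W R) (A : set W) :
  (\forall w \ae P, A w) -> exists w, A w.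
Proof.
move=> [N [mN N0 AN]]; apply: contrapT => nA.
have : P N = 1%E.
  rewrite (_ : N = setT) ?probability_setT //; apply/seteqP; split => // w _.
  by apply: AN => Aw; apply: nA; exists w.
by rewrite N0 => /eqP; rewrite eqe eq_sym oner_eq0.
Qed.

Lemma expR_ge1 (R : realType) (x : R) : 0 <= x -> 1 <= expR x.
Proof. by move=> x0; rewrite (le_trans _ (expR_ge1Dx x)) // lerDl. Qed.

Lemma subrDD_cancel (V : zmodType) (a b p q : V) : (a + p - (b + q)) - (a - b) = p - q.
Proof.
have -> : a + p - (b + q) = (a - b) + (p - q) by rewrite opprD addrACA.
by rewrite addrC addKr.
Qed.

Section uniqueness.
Context (R : realType) (d n : nat) dW (W : measurableType dW) (P : probability W R).
Notation C := (cpath R d).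
Notation leb := (@lebesgue_measure R).

Definition system_drift (Phi : 'rV[R]_d -> ('I_n -> 'rV[R]_d) -> 'rV[R]_d)
    (X : 'I_n -> W -> C) (s : R) (y : 'rV[R]_d) :=
  vintegral P setT (fun w => Phi y (fun j => path_at (X j w) s)).

Variables (Phi : 'I_n -> 'rV[R]_d -> ('I_n -> 'rV[R]_d) -> 'rV[R]_d) (M : R).
Hypothesis M0 : 0 < M.
Hypothesis PhiM : forall i y f y' f',
  `|Phi i y f - Phi i y' f'| <= M * (`|y - y'| + \sum_(j < n) `|f j - f' j|).

(** Part of the notion of solution: the averages that define the drift make
    sense. *)
Definition Phi_integrable (X : 'I_n -> W -> C) := forall i t y, 0 <= t ->
  vintegrable P setT (fun w => Phi i y (fun j => path_at (X j w) t)).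

Definition system_solution (xi X : 'I_n -> W -> C) := forall i,
  \forall w \ae P, forall t, 0 <= t ->
    vintegrable leb `[0, t] (fun s => system_drift (Phi i) X s (path_at (X i w) s)) /\
    path_at (X i w) t = path_at (xi i w) t +
      vintegral leb `[0, t] (fun s => system_drift (Phi i) X s (path_at (X i w) s)).

(* The weight that makes a drift with Lipschitz constant [M] in each of its
   [n + 1] arguments contract on all time intervals. *)
Notation lam := (4 * (n.+1%:R * M)).

Lemma lam_gt0 : 0 < lam.
Proof. by rewrite !mulr_gt0. Qed.

Lemma system_drift_lipschitz X i s y y' : Phi_integrable X -> 0 <= s ->
  `|system_drift (Phi i) X s y - system_drift (Phi i) X s y'| <= M * `|y - y'|.
Proof.
move=> pX s0; rewrite /system_drift -vintegralB //; [|exact: pX|exact: pX].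
rewrite -(Rintegral_cstT P (M * `|y - y'|)).
apply: normr_vintegral_le => //; first by apply: vintegrableB => //; exact: pX.
  exact: integrable_cstT.
move=> w _; apply: (le_trans (PhiM _ _ _ _ _)).
by rewrite big1 ?addr0 // => j _; rewrite subrr normr0.
Qed.

Section moments.
Variables (xi X : 'I_n -> W -> C).
Hypotheses (mxi : forall i, measurable_fun setT (xi i)) (mX : forall i, measurable_fun setT (X i)).
Hypothesis xi1 : forall i, locally_L1 P (xi i).
Hypotheses (pX : Phi_integrable X) (sX : system_solution xi X).

(** The trajectory of a reference outcome [w0] is subtracted.  The drift is an
    average over the law, hence the same function along both trajectories, so their
    distance is controlled by its Lipschitz constant, whatever the moments of
    the solution. *)
Lemma solution_pathwise_bound i t0 : exists w0, \forall w \ae P, forall t, 0 <= t <= t0 ->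
  `|(path_at (X i w) t - path_at (X i w0) t) - (path_at (xi i w) t - path_at (xi i w0) t)| <=
  2 * (M * (time_norm t0 (xi i w) + time_norm t0 (xi i w0))) * expR (lam * t).
Proof.
have [w0 good0] := ae_prob_ex (sX i); exists w0.
apply: filterS (sX i) => w good t t0t.
pose u s := (path_at (X i w) s - path_at (X i w0) s) - (path_at (xi i w) s - path_at (xi i w0) s).
pose c := M * (time_norm t0 (xi i w) + time_norm t0 (xi i w0)).
have c0 : 0 <= c by rewrite mulr_ge0 ?(ltW M0) // addr_ge0 // time_norm_ge0.
rewrite -/c -ler_pdivrMr ?expR_gt0 //.
apply: (@halving R R [set s | 0 <= s <= t0] (fun s => `|u s| / expR (lam * s)) c _ _ c0 t t0t).
  have [b1 _ X1] := path_bounded (X i w) t0; have [b2 _ X2] := path_bounded (X i w0) t0.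
  have [b3 _ X3] := path_bounded (xi i w) t0; have [b4 _ X4] := path_bounded (xi i w0) t0.
  exists ((b1 + b2) + (b3 + b4)) => s /= st; rewrite ler_pdivrMr ?expR_gt0 //.
  have /andP[s0 _] := st.
  have e1 : 1 <= expR (lam * s) by apply: expR_ge1; apply: mulr_ge0 => //; exact: ltW lam_gt0.
  have h : `|u s| <= (b1 + b2) + (b3 + b4).
    apply: (le_trans (ler_normB _ _)); apply: lerD; apply: (le_trans (ler_normB _ _)); apply: lerD.
    - exact: X1.
    - exact: X2.
    - exact: X3.
    - exact: X4.
  by rewrite (le_trans h) // ler_peMr // (le_trans _ h).
move=> N N0 uN s /= /[dup] st /andP[s0 st0]; rewrite ler_pdivrMr ?expR_gt0 //.
have [v1 E1] := good s s0; have [v2 E2] := good0 s s0.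
have -> : u s = vintegral leb `[0, s]
   (fun r => system_drift (Phi i) X r (path_at (X i w) r) -
             system_drift (Phi i) X r (path_at (X i w0) r)).
  by rewrite vintegralB // /u E1 E2 subrDD_cancel.
pose h r : R := M * (`|path_at (xi i w) r| + `|path_at (xi i w0) r|) + M * N * expR (lam * r).
have ih1 : leb.-integrable `[0, s] (EFin \o
    (fun r => M * (`|path_at (xi i w) r| + `|path_at (xi i w0) r|))).
  by apply: integrableZE => //; apply: integrableDE => //; exact: time_norm_integrable.
have ih2 := integrable_expR_itv (M * N) lam s.
apply: (@le_trans _ _ (\int[leb]_(r in `[0, s]) h r)).
  apply: normr_vintegral_le => //; [exact: vintegrableB|exact: integrableDE|].
  move=> r; rewrite /= in_itv /= => /andP[r0 rs].
  have rt0 : 0 <= r <= t0 by rewrite r0 (le_trans rs).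
  apply: (le_trans (system_drift_lipschitz i _ _ pX r0)).
  rewrite /h -mulrA -mulrDr ler_wpM2l ?(ltW M0) //.
  have := uN r rt0; rewrite /= ler_pdivrMr ?expR_gt0 // => ur.
  have -> : path_at (X i w) r - path_at (X i w0) r =
      (path_at (xi i w) r - path_at (xi i w0) r) + u r by rewrite /u subrKC.
  by rewrite (le_trans (ler_normD _ _)) // lerD // ler_normB.
rewrite RintegralD // RintegralZl //; last first.
  by apply: integrableDE => //; exact: time_norm_integrable.
rewrite RintegralD //; [|exact: time_norm_integrable|exact: time_norm_integrable].
rewrite -/(time_norm s (xi i w)) -/(time_norm s (xi i w0)).
have MN0 : 0 <= M * N by rewrite mulr_ge0 // ltW.
have h2 := Rintegral_expR_le MN0 lam_gt0 s0.
have h1 : M * (time_norm s (xi i w) + time_norm s (xi i w0)) <= c.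
  by apply: ler_wpM2l; [exact: ltW|apply: lerD; exact: time_norm_le].
have e1 : 1 <= expR (lam * s) by apply: expR_ge1; apply: mulr_ge0 => //; exact: ltW lam_gt0.
apply: (le_trans (lerD h1 h2)); rewrite [leRHS]mulrDl; apply: lerD.
  by rewrite ler_peMr.
apply: ler_wpM2r; first exact: expR_ge0.
rewrite ler_pdivrMr ?lam_gt0 //.
have n1 : 1 <= n.+1%:R :> R by rewrite ler1n.
rewrite mulrC; have -> : N / 2 * lam = N * (2 * (n.+1%:R * M)) by field.
rewrite ler_wpM2l //; have := ler_wpM2r (ltW M0) n1.
by set k := n.+1%:R; move: M0; lra.
Qed.

(** Taking means over [w] in the pathwise bound, whose right-hand side
    involves the solution only through the fixed trajectory of [w0]. *)
Lemma solution_locally_L1 i : locally_L1 P (X i).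
Proof.
move=> t0; have [w0 bd] := solution_pathwise_bound i t0.
have [b1 b10 X1] := path_bounded (X i w0) t0.
have [b2 b20 X2] := path_bounded (xi i w0) t0.
have [c [c0 xic]] := xi1 i t0.
pose e := expR (lam * `|t0|).
have e0 : 0 <= e by exact: expR_ge0.
pose a := b1 + b2 + 2 * (M * time_norm t0 (xi i w0)) * e.
have a0 : 0 <= a.
  by rewrite !addr_ge0 // !mulr_ge0 // ?time_norm_ge0 // ltW.
have ne : 0 <= 2 * M * e by rewrite !mulr_ge0 // ltW.
exists (a + (c + (2 * M * e) * (c * `|t0|))); split.
  by apply: addr_ge0 => //; apply: addr_ge0 => //; apply: mulr_ge0 => //; exact: mulr_ge0.
move=> t /[dup] tt0 /andP[t_ge0 t_le].
have t0_ge0 : 0 <= t0 by exact: le_trans t_le.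
have mn : measurable_fun setT (fun w => `|path_at (xi i w) t|).
  by apply: measurable_mx_norm; exact: measurable_at.
have mtn : measurable_fun setT (fun w => time_norm t0 (xi i w)) by exact: measurable_time_norm.
apply: (@le_trans _ _ (\int[P]_w (a%:E + (`|path_at (xi i w) t|%:E +
    (2 * M * e)%:E * (time_norm t0 (xi i w))%:E)))%E).
  apply: ae_ge0_le_integral => //.
  - by apply/measurable_EFinP; apply: measurable_mx_norm; exact: measurable_at.
  - move=> w _; rewrite -EFinM -!EFinD lee_fin.
    by apply: addr_ge0 => //; apply: addr_ge0 => //; rewrite mulr_ge0 ?time_norm_ge0.
  - apply: emeasurable_funD => //; apply: emeasurable_funD; first exact/measurable_EFinP.
    by apply: emeasurable_funM => //; exact/measurable_EFinP.
  apply: filterS bd => w bw _; rewrite -EFinM -!EFinD lee_fin.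
  have := bw t tt0; set u := _ - _ => uw.
  have -> : path_at (X i w) t = path_at (X i w0) t + (path_at (xi i w) t - path_at (xi i w0) t + u).
    by rewrite /u !subrKC.
  apply: (le_trans (ler_normD _ _)); rewrite /a.
  have h1 := X1 t tt0; have h2 := X2 t tt0.
  have h3 : `|path_at (xi i w) t - path_at (xi i w0) t + u| <=
      `|path_at (xi i w) t| + `|path_at (xi i w0) t| + `|u|.
    by rewrite (le_trans (ler_normD _ _)) // lerD2r ler_normB.
  have h4 : `|u| <= 2 * (M * (time_norm t0 (xi i w) + time_norm t0 (xi i w0))) * e.
    apply: (le_trans uw); apply: ler_wpM2l.
      by rewrite !mulr_ge0 ?(ltW M0) // addr_ge0 // time_norm_ge0.
    rewrite /e ler_expR; apply: ler_wpM2l; first exact: ltW lam_gt0.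
    by rewrite ger0_norm.
  by lra.
rewrite ge0_integralD //; last 2 first.
- by move=> w _; rewrite -EFinM -EFinD lee_fin addr_ge0 // mulr_ge0 ?time_norm_ge0.
- apply: emeasurable_funD; first exact/measurable_EFinP.
  by apply: emeasurable_funM => //; exact/measurable_EFinP.
rewrite integral_cstT [leRHS]EFinD; apply: leeD => //.
rewrite ge0_integralD //; last 3 first.
- exact/measurable_EFinP.
- by move=> w _; rewrite -EFinM lee_fin mulr_ge0 ?time_norm_ge0.
- by apply: emeasurable_funM => //; exact/measurable_EFinP.
rewrite EFinD; apply: leeD; first exact: xic.
rewrite ge0_integralZl //; last 2 first.
- exact/measurable_EFinP.
- by move=> w _; rewrite lee_fin time_norm_ge0.
rewrite [leRHS]EFinM; apply: lee_wpmul2l => //.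
by rewrite (ger0_norm t0_ge0); exact: integral_time_norm_le.
Qed.

End moments.

Section comparison.
Variables (xi X Z : 'I_n -> W -> C).
Hypotheses (mxi : forall i, measurable_fun setT (xi i)).
Hypotheses (mX : forall i, measurable_fun setT (X i)) (mZ : forall i, measurable_fun setT (Z i)).
Hypothesis xi1 : forall i, locally_L1 P (xi i).
Hypotheses (pX : Phi_integrable X) (sX : system_solution xi X).
Hypotheses (pZ : Phi_integrable Z) (sZ : system_solution xi Z).

Definition mean_gap i t : R := \int[P]_w `|path_at (X i w) t - path_at (Z i w) t|.

Let X1 i : locally_L1 P (X i). Proof. exact: (solution_locally_L1 mxi mX xi1 pX sX). Qed.
Let Z1 i : locally_L1 P (Z i). Proof. exact: (solution_locally_L1 mxi mZ xi1 pZ sZ). Qed.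

Lemma gap_integrable i t : 0 <= t ->
  P.-integrable setT (EFin \o (fun w => `|path_at (X i w) t - path_at (Z i w) t|)).
Proof.
move=> t0; have iX := locally_L1_integrable (mX i) (X1 i) t0.
have iZ := locally_L1_integrable (mZ i) (Z1 i) t0.
apply: (le_integrable _ _ _ (integrableDE _ iX iZ)) => //.
  apply/measurable_EFinP; apply: measurable_mx_norm.
  by apply: measurable_mxB; exact: measurable_at.
by move=> w _ /=; rewrite lee_fin !ger0_norm ?addr_ge0 // ler_normB.
Qed.

Lemma system_drift_dist i s y y' : 0 <= s ->
  `|system_drift (Phi i) X s y - system_drift (Phi i) Z s y'| <=
  M * (`|y - y'| + \sum_(j < n) mean_gap j s).
Proof.
move=> s0; rewrite /system_drift -vintegralB //; [|exact: pX|exact: pZ].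
have is_ : P.-integrable setT (EFin \o (fun w => \sum_(j < n) `|path_at (X j w) s - path_at (Z j w) s|)).
  have h0 : P.-integrable setT
      (fun w => \sum_(j < n) `|path_at (X j w) s - path_at (Z j w) s|%:E)%E.
    by apply: integrable_sum => // j _; exact: gap_integrable.
  by apply: eq_integrable h0 => // w _ /=; rewrite sumEFin.
apply: (@le_trans _ _ (\int[P]_w (M * (`|y - y'| +
    \sum_(j < n) `|path_at (X j w) s - path_at (Z j w) s|)))).
  apply: normr_vintegral_le => //; first by apply: vintegrableB => //; [exact: pX|exact: pZ].
  by apply: integrableZE => //; apply: integrableDE => //; exact: integrable_cstT.
rewrite RintegralZl //; last by apply: integrableDE => //; exact: integrable_cstT.
rewrite ler_wpM2l ?(ltW M0) // RintegralD //; last exact: integrable_cstT.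
rewrite Rintegral_cstT lerD2l.
rewrite /Rintegral; under eq_integral do rewrite -sumEFin.
rewrite integral_sum //; last by move=> j; exact: gap_integrable.
rewrite le_eqVlt; apply/orP; left; apply/eqP.
rewrite -[RHS]/(fine (\sum_(j < n) mean_gap j s)%:E).
by congr fine; rewrite -sumEFin; apply: eq_bigr => j _; rewrite fineK //; exact: integrable_fin_num (gap_integrable j s0).
Qed.

(** A bound in mean enters the drift through the law, and a pathwise Gronwall
    argument turns it into an almost sure bound with half the constant. *)
Lemma gap_pathwise t0 N : 0 <= N ->
  (forall i t, 0 <= t <= t0 -> mean_gap i t <= N * expR (lam * t)) ->
  \forall w \ae P, forall i t, 0 <= t <= t0 ->
    `|path_at (X i w) t - path_at (Z i w) t| <= N / 2 * expR (lam * t).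
Proof.
move=> N0 gapN.
have aeX : \forall w \ae P, forall i, forall t, 0 <= t ->
    vintegrable leb `[0, t] (fun s => system_drift (Phi i) X s (path_at (X i w) s)) /\
    path_at (X i w) t = path_at (xi i w) t +
      vintegral leb `[0, t] (fun s => system_drift (Phi i) X s (path_at (X i w) s)).
  by apply: filter_forall => i; exact: sX.
have aeZ : \forall w \ae P, forall i, forall t, 0 <= t ->
    vintegrable leb `[0, t] (fun s => system_drift (Phi i) Z s (path_at (Z i w) s)) /\
    path_at (Z i w) t = path_at (xi i w) t +
      vintegral leb `[0, t] (fun s => system_drift (Phi i) Z s (path_at (Z i w) s)).
  by apply: filter_forall => i; exact: sZ.
apply: filterS2 aeX aeZ => w gX gZ i t tt0.
rewrite -ler_pdivrMr ?expR_gt0 //.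
(* The mean enters as the constant [N / 4] of [halving], by the choice of [lam]. *)
have -> : N / 2 = 2 * (N / 4) by field.
pose u s := path_at (X i w) s - path_at (Z i w) s.
have N4 : 0 <= N / 4 by rewrite divr_ge0.
apply: (@halving R R [set s | 0 <= s <= t0] (fun s => `|u s| / expR (lam * s)) _ _ _ N4 t tt0).
  have [b1 _ Xb] := path_bounded (X i w) t0; have [b2 _ Zb] := path_bounded (Z i w) t0.
  exists (b1 + b2) => s /= st; rewrite ler_pdivrMr ?expR_gt0 //.
  have /andP[s0 _] := st.
  have e1 : 1 <= expR (lam * s) by apply: expR_ge1; apply: mulr_ge0 => //; exact: ltW lam_gt0.
  have h : `|u s| <= b1 + b2.
    by apply: (le_trans (ler_normB _ _)); apply: lerD; [exact: Xb|exact: Zb].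
  by rewrite (le_trans h) // ler_peMr // (le_trans _ h).
move=> N' N'0 uN s /= /[dup] st /andP[s0 st0]; rewrite ler_pdivrMr ?expR_gt0 //.
have [v1 E1] := gX i s s0; have [v2 E2] := gZ i s s0.
have -> : u s = vintegral leb `[0, s]
   (fun r => system_drift (Phi i) X r (path_at (X i w) r) -
             system_drift (Phi i) Z r (path_at (Z i w) r)).
  by rewrite vintegralB // /u E1 E2 opprD addrACA subrr add0r.
have c0 : 0 <= M * (N' + n%:R * N) by rewrite mulr_ge0 ?(ltW M0) // addr_ge0 // mulr_ge0.
apply: (le_trans (normr_vintegral_expR c0 lam_gt0 s0 _ _)); first exact: vintegrableB.
  move=> r /andP[r0 rs]; have rt0 : 0 <= r <= t0 by rewrite r0 (le_trans rs).
  apply: (le_trans (system_drift_dist i _ _ r0)).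
  rewrite -mulrA ler_wpM2l ?(ltW M0) // mulrDl; apply: lerD.
    by have := uN r rt0; rewrite /= ler_pdivrMr ?expR_gt0.
  have -> : n%:R * N * expR (lam * r) = \sum_(j < n) N * expR (lam * r).
    by rewrite big_const_ord iter_addr_0 -[RHS]mulr_natl -[LHS]mulrA.
  by apply: ler_sum => j _; exact: gapN.
apply: ler_wpM2r; first exact: expR_ge0.
rewrite ler_pdivrMr ?lam_gt0 //.
have n0 : 0 <= n%:R :> R by rewrite ler0n.
rewrite mulrC; have -> : (N / 4 + N' / 2) * lam = (N + 2 * N') * (n.+1%:R) * M by field.
apply: ler_wpM2r; first exact: ltW.
by rewrite -natr1; nra.
Qed.

(** By [gap_pathwise] any bound in mean can be halved, so the gap vanishes. *)
Theorem system_unique : \forall w \ae P, forall i, X i w = Z i w.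
Proof.
have gap0 t0 : forall i t, 0 <= t <= t0 -> mean_gap i t <= 0 * expR (lam * t).
  move=> i t tt0; rewrite -ler_pdivrMr ?expR_gt0 //.
  have := @halving R ('I_n * R) [set it | 0 <= it.2 <= t0]
    (fun it => mean_gap it.1 it.2 / expR (lam * it.2)) 0 _ _ (lexx 0) (i, t) tt0.
  rewrite mulr0; apply.
    have /choice[c cP] : forall j, exists c, 0 <= c /\ forall s, 0 <= s <= t0 -> mean_gap j s <= c.
      move=> j; have [a [a0 Xa]] := X1 j t0; have [b [b0 Zb]] := Z1 j t0.
      exists (a + b); split; first exact: addr_ge0.
      move=> s /[dup] st /andP[s0 _].
      have iX := locally_L1_integrable (mX j) (X1 j) s0.
      have iZ := locally_L1_integrable (mZ j) (Z1 j) s0.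
      apply: (@le_trans _ _ (\int[P]_w (`|path_at (X j w) s| + `|path_at (Z j w) s|))).
        apply: le_Rintegral => //; [exact: gap_integrable|exact: integrableDE|].
        by move=> w _; exact: ler_normB.
      rewrite RintegralD //; apply: lerD; rewrite -lee_fin fineK; do ?exact: integrable_fin_num.
        exact: Xa.
      exact: Zb.
    exists (\sum_(j < n) c j) => -[j s] /= /[dup] st /andP[s0 _].
    have cj : 0 <= c j by have [] := cP j.
    have sc : c j <= \sum_(k < n) c k.
      rewrite (bigD1 j) //= lerDl; apply: sumr_ge0 => k _; by have [] := cP k.
    rewrite ler_pdivrMr ?expR_gt0 //; have [_ /(_ s st) gj] := cP j.
    rewrite (le_trans gj) // (le_trans sc) // ler_peMr ?(le_trans cj) //.
    by apply: expR_ge1; apply: mulr_ge0 => //; exact: ltW lam_gt0.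
  move=> N N0 gapN [j s] /= /[dup] st /andP[s0 _]; rewrite ler_pdivrMr ?expR_gt0 // add0r.
  have gN k r : 0 <= r <= t0 -> mean_gap k r <= N * expR (lam * r).
    by move=> rt; have := gapN (k, r) rt; rewrite /= ler_pdivrMr ?expR_gt0.
  rewrite -lee_fin /mean_gap /Rintegral fineK; last exact: integrable_fin_num (gap_integrable j s0).
  rewrite -[leRHS](integral_cstT P).
  apply: ae_ge0_le_integral => //.
  - by apply/measurable_EFinP; apply: measurable_mx_norm; apply: measurable_mxB; exact: measurable_at.
  - by move=> w _; rewrite lee_fin mulr_ge0 ?expR_ge0 // divr_ge0.
  by apply: filterS (gap_pathwise N0 gN) => w h _; rewrite lee_fin; exact: h.
have ae_eq : \forall w \ae P, forall (m : nat) i t, 0 <= t <= m%:R ->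
    `|path_at (X i w) t - path_at (Z i w) t| <= 0 / 2 * expR (lam * t).
  by apply: ae_foralln => m; apply: gap_pathwise => //; exact: gap0.
apply: filterS ae_eq => w eqw i; apply: cpathP => t t0.
apply/eqP; rewrite -subr_eq0 -normr_le0.
have := eqw (Num.truncn t).+1 i t; rewrite t0 !mul0r; apply.
exact/ltW/truncnS_gt.
Qed.

End comparison.

End uniqueness.

(** * Change of variables *)

Section image_measure.
Context d1 d2 (X : measurableType d1) (Y : measurableType d2) (R : realType).
Variables (mu : {measure set X -> \bar R}) (nu : {measure set Y -> \bar R}).
Variables (phi : X -> Y) (mphi : measurable_fun setT phi).
Hypothesis lawE : forall S, measurable S -> nu S = mu (phi @^-1` S).

Lemma ge0_integral_image (f : Y -> \bar R) : measurable_fun setT f ->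
  (forall y, 0 <= f y)%E -> (\int[nu]_y f y = \int[mu]_x f (phi x))%E.
Proof.
move=> mf f0; pose p : {mfun X >-> Y} := mfun_Sub (mem_set mphi).
rewrite (@eq_measure_integral _ _ _ setT (pushforward mu p)); last by move=> A mA _; exact: lawE.
by rewrite ge0_integral_pushforward.
Qed.

(** The formula holds for the positive and negative parts, hence for their
    difference, be it finite or not. *)
Lemma integral_image (f : Y -> \bar R) : measurable_fun setT f ->
  (\int[nu]_y f y = \int[mu]_x f (phi x))%E.
Proof.
move=> mf; rewrite integralE [RHS]integralE !ge0_integral_image //; last 2 first.
- exact: measurable_funeneg.
- exact: measurable_funepos.
by congr (_ - _)%E; apply: eq_integral => x _; rewrite ?funeposE ?funenegE.
Qed.

Lemma integrable_image (f : Y -> \bar R) : measurable_fun setT f ->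
  nu.-integrable setT f <-> mu.-integrable setT (f \o phi).
Proof.
move=> mf; have mfp : measurable_fun setT (f \o phi) by exact: measurableT_comp.
have e : (\int[nu]_y `|f y| = \int[mu]_x `|f (phi x)|)%E.
  by rewrite ge0_integral_image //; exact: measurableT_comp.
by split=> /integrableP[_ h]; apply/integrableP; split => //; [rewrite -e|rewrite e].
Qed.

Lemma vintegral_image d (f : Y -> 'rV[R]_d) : measurable_fun setT f ->
  vintegral nu setT f = vintegral mu setT (f \o phi).
Proof.
move=> /measurable_mxP mf; apply/rowP => k; rewrite !mxE integral_image //.
exact/measurable_EFinP.
Qed.

Lemma vintegrable_image d (f : Y -> 'rV[R]_d) : measurable_fun setT f ->
  vintegrable nu setT f <-> vintegrable mu setT (f \o phi).
Proof.
move=> /measurable_mxP mf.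
have m k : measurable_fun setT (fun x => (f x 0 k)%:E) by exact/measurable_EFinP.
by split=> vf k; apply/(integrable_image (m k)); exact: vf.
Qed.

End image_measure.

Section pushforward.
Context d1 d2 (X : measurableType d1) (Y : measurableType d2) (R : realType) (d : nat).
Variables (P : probability X R) (phi : X -> Y) (mphi : measurable_fun setT phi).
Variables (f : Y -> 'rV[R]_d) (mf : measurable_fun setT f).
Let p : {mfun X >-> Y} := mfun_Sub (mem_set mphi).

Lemma vintegral_pushforward :
  vintegral (pushforward P phi) setT f = vintegral P setT (f \o phi).
Proof.
exact: (@vintegral_image _ _ _ _ _ P (distribution P p) phi mphi).
Qed.

Lemma vintegrable_pushforward :
  vintegrable (pushforward P phi) setT f <-> vintegrable P setT (f \o phi).
Proof.
exact: (@vintegrable_image _ _ _ _ _ P (distribution P p) phi mphi).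
Qed.

End pushforward.

Section vector_integral_algebra.
Context dT (T : measurableType dT) (R : realType) (d : nat) (P : probability T R).

Lemma vintegrableZ a (f : T -> 'rV[R]_d) : vintegrable P setT f ->
  vintegrable P setT (fun x => a *: f x).
Proof.
move=> vf k; under eq_fun do rewrite mxE.
exact: integrableZE (vf k).
Qed.

Lemma vintegralZ a (f : T -> 'rV[R]_d) : vintegrable P setT f ->
  vintegral P setT (fun x => a *: f x) = a *: vintegral P setT f.
Proof.
move=> vf; apply/rowP => k; rewrite !mxE; under eq_integral do rewrite mxE.
exact: (RintegralZl a _ (vf k)).
Qed.

Lemma vintegrable_cst (y : 'rV[R]_d) : vintegrable P setT (fun=> y).
Proof. by move=> k; exact: integrable_cstT. Qed.

Lemma vintegral_cst (y : 'rV[R]_d) : vintegral P setT (fun=> y) = y.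
Proof. by apply/rowP => k; rewrite mxE; exact: Rintegral_cstT. Qed.

Lemma vintegrable_sum (I : Type) (r : seq I) (p : pred I) (f : I -> T -> 'rV[R]_d) :
  (forall i, vintegrable P setT (f i)) ->
  vintegrable P setT (fun x => \sum_(i <- r | p i) f i x).
Proof.
move=> vf; elim: r => [|i r IH].
  by under eq_fun do rewrite big_nil; exact: vintegrable_cst.
under eq_fun do rewrite big_cons.
by case: (p i) => //; exact: vintegrableD.
Qed.

Lemma vintegral_sum (I : Type) (r : seq I) (p : pred I) (f : I -> T -> 'rV[R]_d) :
  (forall i, vintegrable P setT (f i)) ->
  vintegral P setT (fun x => \sum_(i <- r | p i) f i x) =
  \sum_(i <- r | p i) vintegral P setT (f i).
Proof.
move=> vf; elim: r => [|i r IH].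
  by under eq_fun do rewrite big_nil; rewrite vintegral_cst big_nil.
under eq_fun do rewrite big_cons; rewrite big_cons.
by case: (p i) => //; rewrite vintegralD ?IH //; exact: vintegrable_sum.
Qed.

End vector_integral_algebra.

Lemma lipschitz_bound (R : realType) (V V' : normedModType R) (f : V -> V') :
  lipschitz f -> exists2 L, 0 < L & forall x y, `|f x - f y| <= L * `|x - y|.
Proof.
move=> [M [_ MP]]; exists (`|M| + 1); first by rewrite ltr_wpDl.
move=> x y; have M1 : M < `|M| + 1 by rewrite ltr_pwDr // ler_norm.
exact: (MP _ M1 (x, y)).
Qed.

(** * The two equations as interacting systems *)

Lemma measurable_mx_sum dT (T : measurableType dT) (R : realType) (m n : nat) (I : Type)
    (r : seq I) (p : pred I) (f : I -> T -> 'M[R]_(m, n)) :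
  (forall i, measurable_fun setT (f i)) ->
  measurable_fun setT (fun x => \sum_(i <- r | p i) f i x).
Proof.
move=> mf; elim: r => [|i r IH].
  by under eq_fun do rewrite big_nil; exact: measurable_cst.
under eq_fun do rewrite big_cons.
by case: (p i) => //; exact: measurable_mxD.
Qed.

Section equations.
Context (R : realType) (d : nat) dW (W : measurableType dW) (P : probability W R).
Notation C := (cpath R d).
Notation leb := (@lebesgue_measure R).

(** The starting point and the noise are merged into the driving path. *)
Lemma additive_sdeE (beta g : R -> 'rV[R]_d -> 'rV[R]_d) xi (B X : W -> C) :
  (forall s y, 0 <= s -> beta s y = g s y) ->
  additive_sde P beta xi B X <->
  \forall w \ae P, forall t, 0 <= t ->
    vintegrable leb `[0, t] (fun s => g s (path_at (X w) s)) /\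
    path_at (X w) t = path_at (noise_path (xi w) (B w)) t +
      vintegral leb `[0, t] (fun s => g s (path_at (X w) s)).
Proof.
move=> bg.
have bgE t w : {in `[0, t]%classic, (fun s => beta s (path_at (X w) s)) =1
    (fun s => g s (path_at (X w) s))}.
  by move=> s; rewrite inE /= in_itv /= => /andP[s0 _]; exact: bg.
have gbE t w : {in `[0, t]%classic, (fun s => g s (path_at (X w) s)) =1
    (fun s => beta s (path_at (X w) s))}.
  by move=> s st; rewrite (@bgE t w).
split; apply: filterS => w h t t0; have [vi e] := h t t0; split.
- exact: (@eq_vintegrable _ _ _ _ leb _ (measurable_itv _) _ _ (@bgE t w) vi).
- by rewrite e noise_pathE // (eq_vintegral leb (@bgE t w)) addrAC.
- exact: (@eq_vintegrable _ _ _ _ leb _ (measurable_itv _) _ _ (@gbE t w) vi).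
- by rewrite e noise_pathE // (eq_vintegral leb (@bgE t w)) addrAC.
Qed.

Section mckean_vlasov.
Variables (K1 : 'rV[R]_d -> 'rV[R]_d) (K2 : 'rV[R]_d * 'rV[R]_d -> 'rV[R]_d).
Hypothesis mK2 : forall y, measurable_fun setT (fun x => K2 (y, x)).

(** The McKean-Vlasov equation is a system with a single particle. *)
Definition mv_field (i : 'I_1) (y : 'rV[R]_d) (f : 'I_1 -> 'rV[R]_d) : 'rV[R]_d :=
  K1 y + K2 (y, f ord0).

Lemma mv_system (xi : W -> 'rV[R]_d) (B Y : W -> C) : measurable_fun setT Y ->
  mv_solution P K1 K2 xi B Y <->
  Phi_integrable P mv_field (fun=> Y) /\
  system_solution P mv_field (fun _ w => noise_path (xi w) (B w)) (fun=> Y).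
Proof.
move=> mY.
have vE t y : vintegrable (law_at P Y t) setT (fun x => K2 (y, x)) <->
    vintegrable P setT (fun w => K2 (y, path_at (Y w) t)).
  by apply: vintegrable_pushforward => //; exact: measurable_at.
have intE : (forall t y, 0 <= t -> vintegrable (law_at P Y t) setT (fun x => K2 (y, x))) <->
    Phi_integrable P mv_field (fun=> Y).
  split=> h.
    by move=> i t y t0; apply: vintegrableD => //; [exact: vintegrable_cst|exact/vE/h].
  move=> t y t0; apply/vE.
  have := vintegrableB measurableT (h ord0 t y t0) (vintegrable_cst P (K1 y)).
  by apply: eq_vintegrable => // w _; rewrite /mv_field addrC addKr.
have driftE i : Phi_integrable P mv_field (fun=> Y) -> forall s y, 0 <= s ->
    mv_drift K1 K2 (law_at P Y s) y = system_drift P (mv_field i) (fun=> Y) s y.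
  move=> pY s y s0; have /vE vK := intE.2 pY s y s0.
  rewrite /mv_drift /system_drift /mv_field vintegral_pushforward //; last exact: measurable_at.
  by rewrite vintegralD //; [rewrite vintegral_cst|exact: vintegrable_cst].
rewrite /mv_solution intE; split=> -[pY sY]; split => //.
  by move=> i; apply/(additive_sdeE _ _ _ (driftE i pY)).
by apply/(additive_sdeE _ _ _ (driftE ord0 pY)); exact: sY.
Qed.

End mckean_vlasov.

Section independent_projection.
Variables (n : nat) (K1 : 'rV[R]_d -> 'rV[R]_d) (K2 : 'rV[R]_d * 'rV[R]_d -> 'rV[R]_d).
Variables (A : 'M[R]_n) (b : 'I_n -> 'M[R]_(n, d) -> 'rV[R]_d).
Hypothesis bE : forall i x, b i x =
  K1 (row i x) + \sum_(j < n | j != i) A i j *: K2 (row i x, row j x).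
Hypothesis mK2 : forall y, measurable_fun setT (fun x => K2 (y, x)).

Definition ip_field (i : 'I_n) (y : 'rV[R]_d) (f : 'I_n -> 'rV[R]_d) : 'rV[R]_d :=
  K1 y + \sum_(j < n | j != i) A i j *: K2 (y, f j).

(** Integrating over [x^{-i}] with the [i]-th row replaced by [y] amounts to
    averaging a function of all the particles that ignores the [i]-th. *)
Lemma ip_fieldE i y (f : 'I_n -> 'rV[R]_d) :
  b i (insert_row i y (row' i (\matrix_(j < n) f j))) = ip_field i y f.
Proof.
have rowi : row i (insert_row i y (row' i (\matrix_(j < n) f j))) = y.
  by apply/rowP => k; rewrite !mxE unlift_none.
rewrite bE rowi /ip_field; congr (_ + _); apply: eq_bigr => j ji.
congr (_ *: K2 (_, _)); apply/rowP => k; rewrite !mxE.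
case: unliftP => [l jl|ij]; last by rewrite ij eqxx in ji.
by rewrite !mxE -jl.
Qed.

Lemma measurable_ip_field i y dT (T : measurableType dT) (f : 'I_n -> T -> 'rV[R]_d) :
  (forall j, measurable_fun setT (f j)) ->
  measurable_fun setT (fun x => ip_field i y (fun j => f j x)).
Proof.
move=> mf; apply: measurable_mxD; first exact: measurable_cst.
by apply: measurable_mx_sum => j; apply: measurable_mxZ; exact: (measurableT_comp (mK2 y) (mf j)).
Qed.

Lemma measurable_insert_row i y :
  measurable_fun setT (fun z : 'M[R]_(n.-1, d) => b i (insert_row i y z)).
Proof.
have -> : (fun z => b i (insert_row i y z)) =
    (fun z : 'M[R]_(n.-1, d) => ip_field i y (fun j => row j (insert_row i y z))).
  apply/funext => z; rewrite bE (_ : row i _ = y) //.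
  by apply/rowP => k; rewrite !mxE unlift_none.
apply: measurable_ip_field => j; apply/measurable_mxP => r k.
have -> : (fun z : 'M[R]_(n.-1, d) => row j (insert_row i y z) r k) =
    (fun z => if unlift i j is Some l then z l k else y r k).
  by apply/funext => z; rewrite (ord1 r) !mxE; case: unlift => // l; rewrite mxE.
by case: unlift => [l|]; [exact: measurable_mx_coord|exact: measurable_cst].
Qed.

(** The pushforward of the law of [X_t] under removal of a row is the law of
    the remaining particles, so a change of variables moves all the integrals
    to the probability space. *)
Lemma ip_system (xi : 'I_n -> W -> 'rV[R]_d) (B X : 'I_n -> W -> C) :
  (forall i, measurable_fun setT (X i)) ->
  ip_solution P b xi B X <->
  Phi_integrable P ip_field X /\
  system_solution P ip_field (fun i w => noise_path (xi i w) (B i w)) X.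
Proof.
move=> mX.
have mat t : measurable_fun setT (fun w => \matrix_(i < n) path_at (X i w) t).
  apply/measurable_mxP => i k; under eq_fun do rewrite mxE.
  by apply: (measurableT_comp (measurable_mx_coord 0 k)); exact: measurable_at.
have mdrop i t : measurable_fun setT (fun w => row' i (\matrix_(i < n) path_at (X i w) t)).
  apply/measurable_mxP => j k; under eq_fun do rewrite !mxE.
  by apply: (measurableT_comp (measurable_mx_coord 0 k)); exact: measurable_at.
(* [drop_law] and [joint_law_at] unfold to a single pushforward. *)
have fE i t y : (fun z => b i (insert_row i y z)) \o
    (fun w => row' i (\matrix_(i < n) path_at (X i w) t)) =
    fun w => ip_field i y (fun j => path_at (X j w) t).
  by apply/funext => w; exact: ip_fieldE.
have intE i t y : vintegrable (drop_law i (joint_law_at P X t)) setT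
      (fun z => b i (insert_row i y z)) <->
    vintegrable P setT (fun w => ip_field i y (fun j => path_at (X j w) t)).
  rewrite -fE; apply: vintegrable_pushforward; last exact: measurable_insert_row.
  exact: mdrop.
have driftE i s y : 0 <= s ->
    ip_drift b i (joint_law_at P X s) y = system_drift P (ip_field i) X s y.
  move=> _; rewrite /system_drift -fE; apply: vintegral_pushforward; last exact: measurable_insert_row.
  exact: mdrop.
split=> [sol|[pX sX] i]; split.
- by move=> i t y t0; apply/intE; exact: (sol i).1.
- by move=> i; apply/(additive_sdeE _ _ _ (driftE i)); exact: (sol i).2.
- by move=> t y t0; apply/intE; exact: pX.
- by apply/(additive_sdeE _ _ _ (driftE i)); exact: sX.
Qed.

End independent_projection.
End equations.

(** * Both equations are solved by the same map *)

(** The probability of a grid box is the same on both spaces. *)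
Lemma noise_law_unique (R : realType) (d : nat) dW (W : measurableType dW) (P : probability W R)
    dV (V : measurableType dV) (Q : probability V R)
    (x : W -> 'rV[R]_d) (B : W -> cpath R d) (y : V -> 'rV[R]_d) (B' : V -> cpath R d) :
  measurable_fun setT x -> measurable_fun setT B -> brownian P B -> indep_pair P x B ->
  measurable_fun setT y -> measurable_fun setT B' -> brownian Q B' -> indep_pair Q y B' ->
  (forall S, measurable S -> P (x @^-1` S) = Q (y @^-1` S)) ->
  forall S, measurable S -> P ((fun w => noise_path (x w) (B w)) @^-1` S) =
    Q ((fun w => noise_path (y w) (B' w)) @^-1` S).
Proof.
move=> mx mB bB xB my mB' bB' yB' xy S mS.
pose p : {mfun W >-> cpath R d} := mfun_Sub (mem_set (measurable_noise_path mx mB)).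
pose q : {mfun V >-> cpath R d} := mfun_Sub (mem_set (measurable_noise_path my mB')).
have p1 : distribution P p setT = 1%E := probability_setT (distribution P p).
have q1 : distribution Q q setT = 1%E := probability_setT (distribution Q q).
apply: (@cpath_law_unique _ _ (distribution P p) (distribution Q q)) => //.
- by apply: (@le_lt_trans _ _ 1%E); rewrite ?ltry // -p1.
- exact: etrans p1 (esym q1).
move=> m _ [N [A0 [A [mA0 mA NA ->]]]].
have e1 := noise_grid_box mx mB bB xB m mA0 mA NA.
have e2 := noise_grid_box my mB' bB' yB' m mA0 mA NA.
by rewrite xy // in e1; exact: etrans e1 (esym e2).
Qed.

Section fields.
Context (R : realType) (d : nat).
Variables (K1 : 'rV[R]_d -> 'rV[R]_d) (K2 : 'rV[R]_d * 'rV[R]_d -> 'rV[R]_d) (L1 L2 : R).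
Hypotheses (L10 : 0 <= L1) (L20 : 0 <= L2).
Hypothesis K1L : forall y y', `|K1 y - K1 y'| <= L1 * `|y - y'|.
Hypothesis K2L : forall y x y' x', `|K2 (y, x) - K2 (y', x')| <= L2 * (`|y - y'| + `|x - x'|).

Lemma kernel_lipschitz y x y' x' :
  `|(K1 y + K2 (y, x)) - (K1 y' + K2 (y', x'))| <= (L1 + L2) * (`|y - y'| + `|x - x'|).
Proof.
rewrite opprD addrACA (le_trans (ler_normD _ _)) // [leRHS]mulrDl lerD //.
by rewrite (le_trans (K1L _ _)) // ler_wpM2l // lerDl.
Qed.

(** Summing over the whole of [A] gives one constant for all the particles. *)
Lemma ip_field_lipschitz n (A : 'M[R]_n) i y f y' f' :
  `|ip_field K1 K2 A i y f - ip_field K1 K2 A i y' f'| <=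
  (L1 + L2 * \sum_(k < n) \sum_(j < n) `|A k j|) *
    (`|y - y'| + \sum_(j < n) `|f j - f' j|).
Proof.
set a := \sum_(k < n) _; set D := `|y - y'| + _.
have D0 : 0 <= D by rewrite addr_ge0 // sumr_ge0.
rewrite /ip_field opprD addrACA (le_trans (ler_normD _ _)) // [leRHS]mulrDl lerD //.
  rewrite (le_trans (K1L _ _)) // ler_wpM2l // lerDl sumr_ge0 //.
rewrite -sumrB (le_trans (ler_norm_sum _ _ _)) //.
have row_a : \sum_(j < n) `|A i j| <= a.
  by rewrite /a [leRHS](bigD1 i) //= lerDl; do 2!(apply: sumr_ge0 => ? _).
apply: (@le_trans _ _ (\sum_(j < n) `|A i j| * (L2 * D))).
  rewrite big_mkcond /=; apply: ler_sum => j _; case: ifP => _; last first.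
    by rewrite !mulr_ge0.
  rewrite -scalerBr normrZ ler_wpM2l // (le_trans (K2L _ _ _ _)) //.
  rewrite ler_wpM2l // lerD2l [leRHS](bigD1 j) //= lerDl; exact: sumr_ge0.
by rewrite -mulr_suml mulrA [_ * L2]mulrC ler_wpM2r // ler_wpM2l.
Qed.

End fields.

Section solution_map.
Context (R : realType) (d : nat).
Notation C := (cpath R d).
Notation leb := (@lebesgue_measure R).
Variables (nu : probability C R) (K : 'rV[R]_d * 'rV[R]_d -> 'rV[R]_d) (L : R).
Hypotheses (L0 : 0 < L).
Hypothesis KL : forall y x y' x', `|K (y, x) - K (y', x')| <= L * (`|y - y'| + `|x - x'|).
Variable F : C -> C.
Hypothesis admF : admissible nu F.
Hypothesis FE : forall x t, 0 <= t ->
  path_at (F x) t = path_at x t + vintegral leb `[0, t] (path_drift nu K F x).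

(** A system is solved by applying [F] to each driving path as soon as the
    resulting averages coincide with those of the fixed point equation. *)
Lemma fixpoint_solves dW (W : measurableType dW) (P : probability W R) n
    (Phi : 'I_n -> 'rV[R]_d -> ('I_n -> 'rV[R]_d) -> 'rV[R]_d) (xi : 'I_n -> W -> C) :
  (forall i s y, 0 <= s ->
     system_drift P (Phi i) (fun j w => F (xi j w)) s y = mf_drift nu K F s y) ->
  system_solution P Phi xi (fun j w => F (xi j w)).
Proof.
move=> driftE i; apply: aeW => w t t0.
have e : {in `[0, t]%classic, (fun s => mf_drift nu K F s (path_at (F (xi i w)) s)) =1
   (fun s => system_drift P (Phi i) (fun j w => F (xi j w)) s (path_at (F (xi i w)) s))}.
  by move=> s; rewrite inE /= in_itv /= => /andP[s0 _]; rewrite driftE.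
have [mF F1] := admF.
have v := vintegrable_mf_drift L0 KL mF F1 (F (xi i w)) t0.
split; first exact: (@eq_vintegrable _ _ _ _ leb _ (measurable_itv _) _ _ e v).
by rewrite -(eq_vintegral leb e); exact: FE.
Qed.

End solution_map.

Theorem proposition4p2 (R : realType) (d n : nat) (hd : (0 < d)%N)
  (hn : (0 < n)%N)
  (mu0 : probability 'rV[R]_d R)
  (hmu0 : mu0.-integrable setT (fun x : 'rV[R]_d => (`|x|)%:E))
  (K1 : 'rV[R]_d -> 'rV[R]_d) (hK1 : lipschitz K1)
  (K2 : 'rV[R]_d * 'rV[R]_d -> 'rV[R]_d) (hK2 : lipschitz K2)
  (A : 'M[R]_n) (hAdiag : forall i, A i i = 0)
  (hArow : forall i, \sum_(j < n) A i j = 1)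
  (b : 'I_n -> 'M[R]_(n, d) -> 'rV[R]_d)
  (hb : forall i x, b i x =
     K1 (row i x) + \sum_(j < n | j != i) A i j *: K2 (row i x, row j x))
  (* the data of the independent projection SDE *)
  (dW : measure_display) (W : measurableType dW) (P : probability W R)
  (X0 : 'I_n -> {mfun W >-> 'rV[R]_d})
  (hX0law : forall i S, measurable S -> distribution P (X0 i) S = mu0 S)
  (hX0ind : indep_family P X0)
  (B : 'I_n -> {mfun W >-> cpath R d})
  (hB : forall i, brownian P (B i))
  (hBind : indep_family P B)
  (hX0B : indep_pair P (fun w => [tuple X0 i w | i < n])
                       (fun w => [tuple B i w | i < n]))
  (* the data of the McKean-Vlasov equation *)
  (dV : measure_display) (V : measurableType dV) (Q : probability V R)
  (Y0 : {mfun V >-> 'rV[R]_d})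
  (hY0law : forall S, measurable S -> distribution Q Y0 S = mu0 S)
  (Bbar : {mfun V >-> cpath R d})
  (hBbar : brownian Q Bbar)
  (hY0B : indep_pair Q Y0 Bbar) :
  [/\ (* existence and uniqueness for the independent projection SDE *)
      exists X : 'I_n -> {mfun W >-> cpath R d},
        ip_solution P b X0 B X /\
        forall X' : 'I_n -> {mfun W >-> cpath R d},
          ip_solution P b X0 B X' -> \forall w \ae P, forall i, X' i w = X i w,
      (* existence and uniqueness for the McKean-Vlasov equation *)
      exists Y : {mfun V >-> cpath R d},
        mv_solution Q K1 K2 Y0 Bbar Y /\
        forall Y' : {mfun V >-> cpath R d},
          mv_solution Q K1 K2 Y0 Bbar Y' -> \forall w \ae Q, Y' w = Y w
    & (* the law of X is the n-th power of the law of Y *)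
      forall (X : 'I_n -> {mfun W >-> cpath R d}) (Y : {mfun V >-> cpath R d}),
        ip_solution P b X0 B X -> mv_solution Q K1 K2 Y0 Bbar Y ->
        forall S : set (n.-tuple (cpath R d)), measurable S ->
          pushforward P (fun w => [tuple X i w | i < n]) S =
          power_measure (distribution Q Y) n S].
Proof.

have [L1 L10 K1L] := lipschitz_bound hK1.
have [L2 L20 K2L'] := lipschitz_bound hK2.
have K2L y x y' x' : `|K2 (y, x) - K2 (y', x')| <= L2 * (`|y - y'| + `|x - x'|).
  rewrite (le_trans (K2L' _ _)) // ler_wpM2l ?(ltW L20) //.
  by rewrite prod_normE /= ge_max lerDl lerDr !normr_ge0.
have mK2 y : measurable_fun setT (fun x => K2 (y, x)).
  by apply: (measurable_kernel L20 K2L); [exact: measurable_cst|exact: measurable_id].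
pose K z := K1 z.1 + K2 z.
have L0 : 0 < L1 + L2 by exact: addr_gt0.
have KL y x y' x' : `|K (y, x) - K (y', x')| <= (L1 + L2) * (`|y - y'| + `|x - x'|).
  by apply: kernel_lipschitz => //; exact: ltW.
have mX0 i : measurable_fun setT (X0 i) by exact: measurable_funP.
have mB i : measurable_fun setT (B i) by exact: measurable_funP.
have mY0 : measurable_fun setT Y0 by exact: measurable_funP.
have mBbar : measurable_fun setT Bbar by exact: measurable_funP.
have X0B i : indep_pair P (X0 i) (B i) by exact: (indep_pair_component hX0ind hBind hX0B i).
have mnorm : measurable_fun setT (fun x : 'rV[R]_d => (`|x|)%:E).
  by apply/measurable_EFinP; apply: measurable_mx_norm; exact: measurable_id.
have intX0 i : P.-integrable setT (EFin \o (fun w => `|X0 i w|)).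
  have lawX S : measurable S -> mu0 S = P (X0 i @^-1` S) by move=> /(hX0law i) <-.
  exact/(integrable_image (mX0 i) lawX mnorm).
have intY0 : Q.-integrable setT (EFin \o (fun w => `|Y0 w|)).
  have lawY S : measurable S -> mu0 S = Q (Y0 @^-1` S) by move=> /hY0law <-.
  exact/(integrable_image mY0 lawY mnorm).
pose xi i w := noise_path (X0 i w) (B i w).
pose zeta v := noise_path (Y0 v) (Bbar v).
have mxi i : measurable_fun setT (xi i) by exact: measurable_noise_path.
have mzeta : measurable_fun setT zeta by exact: measurable_noise_path.
have xi1 i : locally_L1 P (xi i) by apply: locally_L1_noise.
have zeta1 : locally_L1 Q zeta by apply: locally_L1_noise.
pose nu : probability (cpath R d) R :=
  distribution Q (mfun_Sub (mem_set mzeta) : {mfun V >-> cpath R d}).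
have nu_zeta S : measurable S -> nu S = Q (zeta @^-1` S) by [].
have nu_xi i S : measurable S -> nu S = P (xi i @^-1` S).
  have lawE U : measurable U -> P (X0 i @^-1` U) = Q (Y0 @^-1` U).
    by move=> mU; exact: etrans (hX0law i U mU) (esym (hY0law U mU)).
  move=> mS; apply: esym.
  exact: (noise_law_unique (mX0 i) (mB i) (hB i) (X0B i) mY0 mBbar hBbar hY0B lawE mS).
have nu1 : locally_L1 nu (@idfun (cpath R d)).
  move=> t0; have [c [c0 cP]] := zeta1 t0; exists c; split => // t tt0.
  rewrite (ge0_integral_image mzeta nu_zeta) //; first exact: cP.
  by apply/measurable_EFinP; apply: measurable_mx_norm; apply: measurable_at; exact: measurable_id.
have [F [mF F1] FE] := picard_fixpoint L0 KL nu1.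
have mK2F s y : measurable_fun setT (fun z => K2 (y, path_at (F z) s)).
  by apply: (measurableT_comp (mK2 y)); exact: measurable_at.
have nuK2 s y : 0 <= s -> vintegrable nu setT (fun z => K2 (y, path_at (F z) s)).
  by move=> s0; exact: (vintegrable_kernel L20 K2L mF F1).
have driftE s y : 0 <= s ->
    mf_drift nu K F s y = K1 y + vintegral nu setT (fun z => K2 (y, path_at (F z) s)).
  move=> s0; rewrite /mf_drift /K vintegralD //=; last exact: nuK2.
    by rewrite vintegral_cst.
  exact: vintegrable_cst.
pose X i w := F (xi i w); pose Y v := F (zeta v).
have mX i : measurable_fun setT (X i) := measurableT_comp mF (mxi i).
have mY : measurable_fun setT Y := measurableT_comp mF mzeta.
pose Phi := ip_field K1 K2 A; pose Psi := mv_field K1 K2.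
have vK2X j s y : 0 <= s -> vintegrable P setT (fun w => K2 (y, path_at (X j w) s)).
  by move=> s0; apply/(vintegrable_image (mxi j) (nu_xi j) (mK2F s y)); exact: nuK2.
have vK2Y s y : 0 <= s -> vintegrable Q setT (fun w => K2 (y, path_at (Y w) s)).
  by move=> s0; apply/(vintegrable_image mzeta nu_zeta (mK2F s y)); exact: nuK2.
have pX : Phi_integrable P Phi X.
  move=> i t y t0; apply: vintegrableD => //; first exact: vintegrable_cst.
  by apply: vintegrable_sum => j; apply: vintegrableZ; exact: vK2X.
have pY : Phi_integrable Q Psi (fun=> Y).
  by move=> i t y t0; apply: vintegrableD => //; [exact: vintegrable_cst|exact: vK2Y].
have sX : system_solution P Phi xi X.
  apply: (fixpoint_solves L0 KL (conj mF F1) FE) => i s y s0.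
  rewrite driftE // /system_drift vintegralD //; last 2 first.
  - exact: vintegrable_cst.
  - by apply: vintegrable_sum => j; apply: vintegrableZ; exact: vK2X.
  rewrite vintegral_cst vintegral_sum; last by move=> j; apply: vintegrableZ; exact: vK2X.
  congr (_ + _); set m := vintegral nu _ _.
  (* The driving paths have the same law, so every average is [m]; the weights
     add up to [1] because [A i i = 0]. *)
  under eq_bigr => j _.
    rewrite vintegralZ; last exact: vK2X.
    rewrite -(vintegral_image (mxi j) (nu_xi j) (mK2F s y)) -/m.
    over.
  rewrite -scaler_suml (_ : \sum_(j < n | j != i) A i j = 1) ?scale1r //.
  by rewrite -(hArow i) [RHS](bigD1 i) //= hAdiag add0r.
have sY : system_solution Q Psi (fun=> zeta) (fun=> Y).
  apply: (fixpoint_solves L0 KL (conj mF F1) FE) => i s y s0.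
  rewrite driftE // /system_drift vintegralD //; last 2 first.
  - exact: vintegrable_cst.
  - exact: vK2Y.
  by rewrite vintegral_cst -(vintegral_image mzeta nu_zeta (mK2F s y)).
have PhiL : forall i y f y' f', `|Phi i y f - Phi i y' f'| <= 
    (L1 + L2 * \sum_(k < n) \sum_(j < n) `|A k j|) * (`|y - y'| + \sum_(j < n) `|f j - f' j|).
  by move=> *; apply: ip_field_lipschitz => //; exact: ltW.
have PsiL : forall i y f y' f', `|Psi i y f - Psi i y' f'| <=
    (L1 + L2) * (`|y - y'| + \sum_(j < 1) `|f j - f' j|).
  by move=> i y f y' f'; rewrite big_ord1; exact: KL.
have M0 : 0 < L1 + L2 * \sum_(k < n) \sum_(j < n) `|A k j|.
  rewrite ltr_wpDr // mulr_ge0 ?(ltW L20) //.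
  by apply: sumr_ge0 => k _; exact: sumr_ge0.
have uniqX (X' : 'I_n -> {mfun W >-> cpath R d}) :
    ip_solution P b X0 B X' -> \forall w \ae P, forall i, X' i w = X i w.
  have mX' i : measurable_fun setT (X' i) by exact: measurable_funP.
  move=> /(ip_system P hb mK2 _ _ mX')[pX' sX'].
  exact: (system_unique M0 PhiL mxi mX' mX xi1 pX' sX' pX sX).
have uniqY (Y' : {mfun V >-> cpath R d}) :
    mv_solution Q K1 K2 Y0 Bbar Y' -> \forall v \ae Q, Y' v = Y v.
  have mY' : measurable_fun setT Y' by exact: measurable_funP.
  move=> /(mv_system Q K1 mK2 _ _ mY')[pY' sY'].
  have := system_unique L0 PsiL (fun=> mzeta) (fun=> mY') (fun=> mY) (fun=> zeta1)
    pY' sY' pY sY.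
  by apply: filterS => v /(_ ord0).
have solX : ip_solution P b X0 B X.
  exact: (proj2 (ip_system P hb mK2 X0 B mX) (conj pX sX)).
have solY : mv_solution Q K1 K2 Y0 Bbar Y.
  exact: (proj2 (mv_system Q K1 mK2 Y0 Bbar mY) (conj pY sY)).
split.
- exists (fun i => mfun_Sub (mem_set (mX i))); split; last exact: uniqX.
  exact: solX.
- exists (mfun_Sub (mem_set mY)); split; last exact: uniqY.
  exact: solY.
move=> X' Y' /uniqX X'E /uniqY Y'E.
have mX' i : measurable_fun setT (X' i) by exact: measurable_funP.
have mtuple : measurable_fun setT (fun w => [tuple X' i w | i < n]).
  apply/measurable_fun_tnthP => i.
  by rewrite (_ : _ \o _ = X' i) //; apply/funext => w /=; rewrite tnth_mktuple.
pose p : {mfun W >-> n.-tuple (cpath R d)} := mfun_Sub (mem_set mtuple).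
have p1 : distribution P p setT = 1%E := probability_setT (distribution P p).
apply: (@tuple_law_unique _ _ _ _ (distribution P p) (power_measure (distribution Q Y') n)).
  by apply: (@le_lt_trans _ _ 1%E); rewrite ?ltry // -p1.
move=> E mE; apply: etrans (esym (power_measure_box (distribution Q Y') mE)).
(* Almost surely [X' i] is a function of the pair [(X0 i, B i)], and these
   pairs are independent. *)
pose Z i (xb : 'rV[R]_d * cpath R d) := E i (F (noise_path xb.1 xb.2)).
have mZ i : measurable (Z i).
  rewrite -[X in measurable X]setTI.
  have mFN : measurable_fun setT (fun xb : 'rV[R]_d * cpath R d => F (noise_path xb.1 xb.2)).
    exact: (measurableT_comp mF (measurable_noise_path measurable_fst measurable_snd)).
  exact: mFN.
have indXB := indep_family_pairs mX0 mB hX0ind hBind hX0B.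
transitivity (P [set w | forall i, Z i (X0 i w, B i w)]).
  apply: (ae_eq_measure (mu := P)).
  - rewrite -[X in measurable X]setTI; exact: (mtuple measurableT _ (measurable_tuple_box mE)).
  - by apply: measurable_forall => i; rewrite -[X in measurable X]setTI; exact: mX.
  apply: filterS X'E => w X'E; split=> h i.
    by have := h i; rewrite tnth_mktuple X'E.
  by rewrite tnth_mktuple X'E; exact: h.
rewrite indXB //; apply: eq_bigr => i _.
have mFE : measurable (F @^-1` E i) by rewrite -[X in measurable X]setTI; exact: mF.
transitivity (nu (F @^-1` E i)); first by rewrite (nu_xi i).
apply: (ae_eq_measure (mu := Q)).
- by rewrite -[X in measurable X]setTI; exact: (mzeta measurableT _ mFE).
- by rewrite -[X in measurable X]setTI; exact: measurable_funP.
by apply: filterS Y'E => v Y'E; rewrite /preimage /= Y'E.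
Qed.
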